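(* Let $n\geqslant 1$ and let $T=(T_1,\dots,T_l)$ be a finite collection of linear differential operators with constant (complex) coefficients on the torus $\mathbb{T}^n$. Suppose there exist positive real numbers $a_1,\dots,a_n$ such that $\sum_{k=1}^n \alpha_k/a_k\leqslant 1$ for every multiindex $\alpha=(\alpha_1,\dots,\alpha_n)$ for which the monomial $D^\alpha$ occurs with nonzero coefficient in at least one $T_j$, and such that among the corresponding senior parts $\tau_1,\dots,\tau_l$ (where $\tau_j$ is the sum of those terms $c_\alpha D^\alpha$ of $T_j$ with $\sum_{k}\alpha_k/a_k=1$) there are at least two linearly independent operators. Then the bidual of $C^T(\mathbb{T}^n)$ is not isomorphic to a complemented subspace of $C(K)$ for any compact Hausdorff space $K$.
   Context: The torus $\mathbb{T}$ is parametrised by $t\mapsto e^{2\pi i t}$, $t\in[0,1)$, and $\partial_j f$ denotes the derivative of $f(e^{2\pi i t_1},\dots,e^{2\pi i t_n})$ with respect to $t_j$. For a multiindex $\alpha$ of nonnegative integers, $D^\alpha=\partial_1^{\alpha_1}\cdots\partial_n^{\alpha_n}$; a differential operator with constant coefficients is a finite linear combination of such monomials. Given $T=(T_1,\dots,T_l)$, define on trigonometric polynomials in $n$ variables the seminorm $\|f\|_T=\max_{1\leqslant j\leqslant l}\|T_jf\|_{C(\mathbb{T}^n)}$; the Banach space $C^T(\mathbb{T}^n)$ is obtained from this seminormed space by factoring over the null space and completing. *)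

(* Defs.v *)
From HB Require Import structures.
From mathcomp Require Import all_boot all_order all_algebra.
From mathcomp Require Import all_classical all_reals all_analysis.
From mathcomp Require Import complex.
Set Implicit Arguments. Unset Strict Implicit. Unset Printing Implicit Defensive.
Import Order.TTheory GRing.Theory Num.Theory.
Import numFieldNormedType.Exports.
Local Open Scope classical_set_scope.
Local Open Scope ring_scope.

Section TorusDefs.
Variable R : realType.
Local Notation C := R[i].

Definition cabs (z : C) : R := Num.sqrt (complex.Re z ^+ 2 + complex.Im z ^+ 2).

Definition ee (x : R) : C := Complex (cos (2 * pi * x)) (sin (2 * pi * x)).

Variable n : nat.

(* A function on T^n is identified with the function
   t |-> f(e^{2 pi i t_1}, ..., e^{2 pi i t_n}) on R^n. *)
Definition tfun := ('I_n -> R) -> C.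

Definition is_trigpoly (f : tfun) : Prop :=
  exists s : seq (('I_n -> int) * C),
    f = fun t => \sum_(p <- s) p.2 * ee (\sum_(k < n) ((p.1 k)%:~R * t k)).

Definition upd (t : 'I_n -> R) (j : 'I_n) (s : R) : 'I_n -> R :=
  fun k => if k == j then s else t k.

Definition pd (j : 'I_n) (f : tfun) : tfun := fun t =>
  Complex (derive1 (fun s => complex.Re (f (upd t j s))) (t j))
          (derive1 (fun s => complex.Im (f (upd t j s))) (t j)).

Definition Dalpha (alpha : 'I_n -> nat) (f : tfun) : tfun :=
  foldr (fun j g => iter (alpha j) (pd j) g) f (enum 'I_n).

Variable N : nat.
Definition mindex := {ffun 'I_n -> 'I_N}.
Definition mi (alpha : mindex) : 'I_n -> nat := fun k => nat_of_ord (alpha k).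

(* a linear differential operator with constant complex coefficients
   (of order < N in each variable): sum_alpha c alpha D^alpha *)
Definition diffop := mindex -> C.

Definition apply_op (c : diffop) (f : tfun) : tfun := fun t =>
  \sum_(alpha : mindex) c alpha * Dalpha (mi alpha) f t.

Definition wdeg (a : 'I_n -> R) (alpha : mindex) : R :=
  \sum_(k < n) (mi alpha k)%:R / a k.

Definition senior (a : 'I_n -> R) (c : diffop) : diffop :=
  fun alpha => if wdeg a alpha == 1 then c alpha else 0.

Definition lin_indep2 (c1 c2 : diffop) : Prop :=
  forall x y : C, (forall alpha, x * c1 alpha + y * c2 alpha = 0) ->
    x = 0 /\ y = 0.

Variable l : nat.
Variable T : 'I_l -> diffop.

Definition normT (f : tfun) : R :=
  \big[Num.max/0]_(j < l) sup [set cabs (apply_op (T j) f t) | t in [set: 'I_n -> R]].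

(* The dual of C^T(T^n): functionals on trigonometric polynomials that are
   linear and bounded w.r.t. ||.||_T (these are exactly the continuous linear
   functionals on the completion of the quotient). *)
Definition is_dual (phi : tfun -> C) : Prop :=
  (forall (x : C) f g, is_trigpoly f -> is_trigpoly g ->
     phi (fun t => x * f t + g t) = x * phi f + phi g) /\
  exists M : R, forall f, is_trigpoly f -> cabs (phi f) <= M * normT f.

Definition dnorm (phi : tfun -> C) : R :=
  sup [set cabs (phi f) | f in [set f | is_trigpoly f /\ normT f <= 1]].

Definition is_bidual (Psi : (tfun -> C) -> C) : Prop :=
  (forall (x : C) phi1 phi2, is_dual phi1 -> is_dual phi2 ->
     Psi (fun f => x * phi1 f + phi2 f) = x * Psi phi1 + Psi phi2) /\
  exists M : R, forall phi, is_dual phi -> cabs (Psi phi) <= M * dnorm phi.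

Definition ddnorm (Psi : (tfun -> C) -> C) : R :=
  sup [set cabs (Psi phi) | phi in [set phi | is_dual phi /\ dnorm phi <= 1]].

End TorusDefs.

Section CK.
Variable R : realType.
Local Notation C := R[i].
Variable K : topologicalType.

Definition is_CK (g : K -> C) : Prop :=
  continuous (fun x => complex.Re (g x)) /\ continuous (fun x => complex.Im (g x)).

Definition supn (g : K -> C) : R := sup (range (fun x => cabs (g x))).
End CK.

(* X (with elements in the predicate inX, norm nX) is isomorphic to a
   complemented subspace of C(K): there are bounded linear maps
   J : X -> C(K) and P : C(K) -> X with P o J = id_X
   (eqX is the equality of elements of X). *)
Definition iso_compl_CK (R : realType) (K : topologicalType) (V : Type)
  (inX : V -> Prop) (nX : V -> R) (addX : R[i] -> V -> V -> V)
  (eqX : V -> V -> Prop) : Prop :=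
  exists (J : V -> K -> R[i]) (P : (K -> R[i]) -> V),
    (forall v, inX v -> is_CK (J v)) /\
    (forall x v w, inX v -> inX w ->
        J (addX x v w) = (fun k => x * J v k + J w k)) /\
    (exists M : R, forall v, inX v -> supn (J v) <= M * nX v) /\
    (forall g, is_CK g -> inX (P g)) /\
    (forall x g h, is_CK g -> is_CK h ->
        eqX (P (fun k => x * g k + h k)) (addX x (P g) (P h))) /\
    (exists M : R, forall g, is_CK g -> nX (P g) <= M * supn g) /\
    (forall v, inX v -> eqX (P (J v)) v).

(* Main.v *)
(** If [X = C^T(T^n)] had a bidual complemented in some [C(K)], then every operator [V] of finite
    rank on [X] that is bounded by [B] from the Sobolev space [W^T_1] (sup norms replaced by
    [L^1] norms) to [X] would have trace at most a constant times [B]: a partition of unity on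
    [K] writes the trace as a sum of values of elements of [X**] on functionals dominated by
    [L^1] norms, and the Hahn-Banach theorem turns this domination into a bound by sup norms of
    signed sums.

    Fourier multipliers violate this. Choose real points [p] and [q] that differ in one
    coordinate [j0] and at which the symbols [tau_1], [tau_2] of the two senior parts are not
    proportional. Dilate [p] and [q] anisotropically with very lacunary factors, and let [V] be
    the multiplier with weights [1/L_k] on [L_k] consecutive frequencies (in direction [j0])
    near the k-th dilate of [p], so that [m] blocks give trace [m]. Modulo summable errors,
    [T_j V f] is [(beta_j T_2 f + gamma_j T_1 f) * b], where the kernel [b] has weights [1/L_k] near
    the dilates of [p] and [-1/L_k] near those of [q]; this is possible because the coefficients
    may be chosen so that [beta_j tau_2 + gamma_j tau_1] is [tau_j] at [p] and vanishes at [q].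
    As [b] is a lacunary sum of terms [(1 - e(M_k x)) D_k(x)] with [D_k] a normalized Dirichlet
    kernel, it is bounded uniformly in [m]. *)
Require Import Defs.
From HB Require Import structures.
From mathcomp Require Import all_boot all_order all_algebra.
From mathcomp Require Import all_classical all_reals all_analysis.
From mathcomp Require Import finmap complex ring lra.
Import Order.TTheory GRing.Theory Num.Theory.
Import numFieldNormedType.Exports.
Set Implicit Arguments. Unset Strict Implicit. Unset Printing Implicit Defensive.
Local Open Scope classical_set_scope.
Local Open Scope ring_scope.

(** * Complex absolute value and exponentials *)

Section Cabs.
Variable R : realType.
Local Notation C := R[i].
Implicit Types x y z : C.
Lemma cabsE z : cabs z = complex.Re `|z|. Proof. by case: z. Qed.
Lemma normr_cabs z : `|z| = (cabs z)%:C%C. Proof. by case: z. Qed.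
Lemma cabs_ge0 z : 0 <= cabs z. Proof. exact: sqrtr_ge0. Qed.
Lemma cabsM : {morph @cabs R : x y / x * y >-> x * y}.
Proof. by move=> x y; rewrite !cabsE normrM !normr_cabs -rmorphM. Qed.
Lemma cabsD x y : cabs (x + y) <= cabs x + cabs y.
Proof. by move: (ler_normD x y); rewrite !normr_cabs -rmorphD lecR. Qed.
Lemma cabsN x : cabs (- x) = cabs x. Proof. by rewrite !cabsE normrN. Qed.
Lemma cabsB x y : cabs (x - y) = cabs (y - x). Proof. by rewrite !cabsE distrC. Qed.
Lemma cabs0 : cabs (0 : C) = 0. Proof. by rewrite cabsE normr0. Qed.
Lemma cabs1 : cabs (1 : C) = 1. Proof. by rewrite cabsE normr1. Qed.
Lemma cabs_eq0 x : (cabs x == 0) = (x == 0).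
Proof. by rewrite -[x == 0]normr_eq0 normr_cabs -(inj_eq (@complexI R)). Qed.
Lemma cabs_gt0 x : (0 < cabs x) = (x != 0).
Proof. by rewrite lt_def cabs_ge0 andbT cabs_eq0. Qed.
Lemma cabs_real (r : R) : cabs r%:C%C = `|r|.
Proof. by rewrite /cabs /= expr0n addr0 sqrtr_sqr. Qed.
Lemma cabs_i : cabs ('i%C : C) = 1.
Proof. by rewrite /cabs /= expr0n add0r expr1n sqrtr1. Qed.
Lemma cabsX x m : cabs (x ^+ m) = cabs x ^+ m.
Proof. by elim: m => [|m IH]; rewrite ?expr0 ?cabs1 // !exprS cabsM IH. Qed.
Lemma cabsV x : cabs x^-1 = (cabs x)^-1.
Proof.
have [->|x0] := eqVneq x 0; first by rewrite invr0 cabs0 invr0.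
by apply: (mulfI (_ : cabs x != 0)); rewrite ?cabs_eq0 // -cabsM !divff ?cabs1 ?cabs_eq0.
Qed.
Lemma Re_le_cabs x : `|complex.Re x| <= cabs x.
Proof. by case: x => a b; rewrite /cabs /= -sqrtr_sqr ler_wsqrtr // lerDl sqr_ge0. Qed.
Lemma Im_le_cabs x : `|complex.Im x| <= cabs x.
Proof. by case: x => a b; rewrite /cabs /= -sqrtr_sqr ler_wsqrtr // lerDr sqr_ge0. Qed.
Lemma cabs_le_ReIm x : cabs x <= `|complex.Re x| + `|complex.Im x|.
Proof.
have -> : x = (complex.Re x)%:C%C + 'i%C * (complex.Im x)%:C%C.
  by case: x => a b /=; simpc.
by rewrite (le_trans (cabsD _ _)) // cabsM cabs_i mul1r !cabs_real; case: x => a b /=; simpc.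
Qed.
Lemma cabs_sum (I : Type) (s : seq I) (P : pred I) (F : I -> C) :
  cabs (\sum_(i <- s | P i) F i) <= \sum_(i <- s | P i) cabs (F i).
Proof.
elim/big_rec2: _ => [|i y x _ h]; first by rewrite cabs0.
by rewrite (le_trans (cabsD _ _)) // lerD2l.
Qed.

Lemma eeD (x y : R) : ee (x + y) = ee x * ee y.
Proof. by rewrite /ee mulrDr cosD sinD; simpc; congr Complex; rewrite addrC. Qed.
Lemma ee0 : ee (0 : R) = 1.
Proof. by rewrite /ee mulr0 cos0 sin0. Qed.
Lemma cabs_ee (x : R) : cabs (ee x) = 1.
Proof. by rewrite /cabs /ee /= cos2Dsin2 sqrtr1. Qed.
Lemma eeN_mul (x : R) : ee (- x) * ee x = 1.
Proof. by rewrite -eeD addNr ee0. Qed.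
Lemma eeMn (x : R) m : ee (m%:R * x) = ee x ^+ m.
Proof. by elim: m => [|m IH]; rewrite ?mul0r ?ee0 // -natr1 mulrDl mul1r eeD IH exprSr. Qed.
Lemma ee1 : ee (1 : R) = 1.
Proof. by rewrite /ee mulr1 mulr_natl cos2pi sin2pi. Qed.
Lemma ee_int (z : int) : ee (z%:~R : R) = 1.
Proof.
case: z => m; first by rewrite -pmulrn -[m%:R]mulr1 eeMn ee1 expr1n.
rewrite NegzE mulrNz; move: (eeN_mul (m.+1%:R : R)).
by rewrite -{2}[m.+1%:R]mulr1 eeMn ee1 expr1n mulr1 -pmulrn.
Qed.
End Cabs.

(** * Trigonometric polynomials and symbols *)

Section Trig.
Variable R : realType.
Local Notation C := R[i].
Variable n : nat.
Implicit Types (f g : tfun R n) (xi : 'I_n -> int) (s : seq (('I_n -> int) * C)).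

Definition mono xi : tfun R n := fun t => ee (\sum_(k < n) ((xi k)%:~R * t k)).
Definition tp s : tfun R n := fun t => \sum_(p <- s) p.2 * mono p.1 t.

Lemma tp_cons p s t : tp (p :: s) t = p.2 * mono p.1 t + tp s t.
Proof. by rewrite /tp big_cons. Qed.

Definition ci (x : R) : C := Complex 0 (2 * pi * x).
(** The Fourier multiplier with symbol [m], acting on lists of frequencies and coefficients. A list
    may repeat a frequency, so it presents a polynomial without being its Fourier series. *)
Definition scal s (m : ('I_n -> int) -> C) := [seq (p.1, m p.1 * p.2) | p <- s].

Lemma tp_scal s m t : tp (scal s m) t = \sum_(p <- s) m p.1 * p.2 * mono p.1 t.
Proof. by rewrite /tp big_map. Qed.

Lemma is_derive_ReIm (c : C) (A w x : R) :
  is_derive x 1 (fun y : R => complex.Re (c * ee (A * y + w)))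
     (complex.Re (ci A * c * ee (A * x + w))) /\
  is_derive x 1 (fun y : R => complex.Im (c * ee (A * y + w)))
     (complex.Im (ci A * c * ee (A * x + w))).
Proof.
case: c => u v; rewrite /ee /ci; simpc.
pose L : R -> R := fun y => 2 * pi * (A * y + w).
have dL : is_derive x 1 L (2 * pi * A).
  have -> : L = (2 * pi) \*: (A \*: id + cst w).
    by apply/funext => y; rewrite /L /= [in RHS]/GRing.scale /=.
  by apply: is_derive_eq; rewrite addr0 /GRing.scale /= mulr1.
have dc : is_derive x 1 (cos \o L) (- sin (L x) * (2 * pi * A)).
  exact: is_derive1_comp.
have ds : is_derive x 1 (sin \o L) (cos (L x) * (2 * pi * A)).
  exact: is_derive1_comp.
split.
  rewrite (_ : (fun y : R => _) = u \*: (cos \o L) - v \*: (sin \o L)) //.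
  by apply: is_derive_eq; rewrite /GRing.scale /= -/(L x); ring.
rewrite (_ : (fun y : R => _) = u \*: (sin \o L) + v \*: (cos \o L)) //.
by apply: is_derive_eq; rewrite /GRing.scale /= -/(L x); ring.
Qed.

Lemma mono_upd xi t j : exists w, forall y,
  mono xi (upd t j y) = ee ((xi j)%:~R * y + w).
Proof.
exists (\sum_(k < n | k != j) ((xi k)%:~R * t k)) => y.
rewrite /mono (bigD1 j) //= /upd eqxx; congr (ee (_ + _)).
by apply: eq_bigr => k /negbTE ->.
Qed.

Lemma upd_id (t : 'I_n -> R) j : upd t j (t j) = t.
Proof. by apply/funext => k; rewrite /upd; case: eqP => // ->. Qed.

Lemma pd_tp j s : pd j (tp s) = tp (scal s (fun xi => ci (xi j)%:~R)).
Proof.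
apply/funext => t; rewrite /pd.
suff [h1 h2] :
  is_derive (t j) 1 (fun y : R => complex.Re (tp s (upd t j y)))
     (complex.Re (tp (scal s (fun xi => ci (xi j)%:~R)) t)) /\
  is_derive (t j) 1 (fun y : R => complex.Im (tp s (upd t j y)))
     (complex.Im (tp (scal s (fun xi => ci (xi j)%:~R)) t)).
  by rewrite !derive1E !derive_val; case: (tp _ t).
elim: s => [|p s [IH1 IH2]].
  by split; rewrite /tp big_nil /=;
   rewrite (_ : (fun _ => _) = cst 0) ?funeqE => [|y]; rewrite ?big_nil //; exact: is_derive_cst.
have [w hw] := mono_upd p.1 t j.
have hw' : mono p.1 t = ee ((p.1 j)%:~R * t j + w) by rewrite -hw upd_id.
have [d1 d2] := is_derive_ReIm p.2 (p.1 j)%:~R w (t j).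
have e y : tp (p :: s) (upd t j y) =
     p.2 * ee ((p.1 j)%:~R * y + w) + tp s (upd t j y) by rewrite tp_cons hw.
split.
  rewrite (_ : (fun y : R => _) = (fun y : R => complex.Re (p.2 * ee ((p.1 j)%:~R * y + w)))
     + (fun y : R => complex.Re (tp s (upd t j y)))); last first.
    by apply/funext => y; rewrite e raddfD.
  by rewrite /scal /= tp_cons /= raddfD /= hw'; apply: is_deriveD.
rewrite (_ : (fun y : R => _) = (fun y : R => complex.Im (p.2 * ee ((p.1 j)%:~R * y + w)))
     + (fun y : R => complex.Im (tp s (upd t j y)))); last first.
    by apply/funext => y; rewrite e raddfD.
by rewrite /scal /= tp_cons /= raddfD /= hw'; apply: is_deriveD.
Qed.

Lemma scal_scal s m m' : scal (scal s m) m' = scal s (fun xi => m' xi * m xi).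
Proof. by rewrite /scal -map_comp; apply: eq_map => p /=; rewrite mulrA. Qed.

Lemma eq_scal s m m' : m =1 m' -> scal s m = scal s m'.
Proof. by move=> h; apply: eq_map => p; rewrite h. Qed.

Lemma scal1 s : scal s (fun=> 1) = s.
Proof. by rewrite /scal -[RHS]map_id; apply: eq_map => -[a b] /=; rewrite mul1r. Qed.

(** The symbol of $D^\alpha$, defined at real and not only integer points because the senior symbols
    are later evaluated at arbitrary real [p] and [q]. *)
Definition msym (x : 'I_n -> R) (alpha : 'I_n -> nat) : C :=
  \prod_(k < n) ci (x k) ^+ alpha k.

Lemma Dalpha_tp alpha s :
  Dalpha alpha (tp s) = tp (scal s (fun xi => msym (fun k => (xi k)%:~R) alpha)).
Proof.
rewrite /Dalpha /msym.
under [in RHS]eq_scal => xi do rewrite -big_enum /=.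
elim: (enum 'I_n) => [|j r IH] /=.
  by under eq_scal => xi do rewrite big_nil; rewrite scal1.
rewrite IH; under [in RHS]eq_scal => xi do rewrite big_cons.
elim: (alpha j) => [|m IHm] /=.
  by congr tp; apply: eq_scal => xi; rewrite expr0 mul1r.
rewrite IHm pd_tp scal_scal; congr tp; apply: eq_scal => xi.
by rewrite exprS mulrA.
Qed.

Variable N : nat.
Definition symb (c : diffop R n N) (x : 'I_n -> R) : C :=
  \sum_alpha c alpha * msym x (mi alpha).
Definition isymb c xi := symb c (fun k => (xi k)%:~R).

Lemma apply_op_tp (c : diffop R n N) s :
  apply_op c (tp s) = tp (scal s (isymb c)).
Proof.
apply/funext => t; rewrite /apply_op tp_scal.
under eq_bigr => a _ do rewrite Dalpha_tp tp_scal mulr_sumr.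
rewrite exchange_big /=; apply: eq_bigr => p _.
by rewrite /isymb /symb !mulr_suml; apply: eq_bigr => a _; rewrite !mulrA.
Qed.

Lemma cabs_mono xi t : cabs (mono xi t) = 1. Proof. exact: cabs_ee. Qed.

Lemma cabs_tp s t : cabs (tp s t) <= \sum_(p <- s) cabs p.2.
Proof.
rewrite (le_trans (cabs_sum _ _ _)) // ler_sum // => p _.
by rewrite cabsM cabs_mono mulr1.
Qed.

Lemma tp_lin (x : C) s s' :
  (fun t => x * tp s t + tp s' t) = tp (scal s (fun=> x) ++ s').
Proof.
apply/funext => t; rewrite /tp big_cat big_map /= mulr_sumr; congr (_ + _).
by apply: eq_bigr => p _; rewrite mulrA.
Qed.

Lemma trigpoly_lin (x : C) f g : is_trigpoly f -> is_trigpoly g ->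
  is_trigpoly (fun t => x * f t + g t).
Proof. by move=> [s ->] [s' ->]; rewrite tp_lin; eexists. Qed.

Lemma trigpoly0 : is_trigpoly (fun _ : 'I_n -> R => 0 : C).
Proof. by exists [::]; apply/funext => t; rewrite big_nil. Qed.

Lemma trigpoly_mono xi : is_trigpoly (mono xi).
Proof. by exists [:: (xi, 1)]; apply/funext => t; rewrite big_seq1 mul1r. Qed.

Lemma trigpolyZ (x : C) f : is_trigpoly f -> is_trigpoly (fun t => x * f t).
Proof.
move=> tf; have := trigpoly_lin x tf trigpoly0.
by under eq_fun do rewrite addr0.
Qed.

Lemma trigpoly_sum (I : Type) (r : seq I) (x : I -> C) (f : I -> tfun R n) :
  (forall i, is_trigpoly (f i)) -> is_trigpoly (fun t => \sum_(i <- r) x i * f i t).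
Proof.
move=> tf; elim: r => [|i r IH].
  by under eq_fun do rewrite big_nil; exact: trigpoly0.
by under eq_fun do rewrite big_cons; exact: trigpoly_lin.
Qed.

Lemma trigpoly_apply_op (c : diffop R n N) f : is_trigpoly f -> is_trigpoly (apply_op c f).
Proof. by move=> [s ->]; rewrite -/(tp s) apply_op_tp; eexists. Qed.

Lemma apply_op_lin (c : diffop R n N) (x : C) f g : is_trigpoly f -> is_trigpoly g ->
  apply_op c (fun t => x * f t + g t) = fun t => x * apply_op c f t + apply_op c g t.
Proof.
move=> [s ->] [s' ->]; rewrite -!/(tp _) tp_lin !apply_op_tp tp_lin; congr tp.
rewrite /scal map_cat -!map_comp; congr cat; apply: eq_map => p /=.
by rewrite mulrCA.
Qed.

Lemma apply_op0 (c : diffop R n N) : apply_op c (fun=> 0) = fun=> 0.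
Proof.
have -> : (fun=> 0) = tp [::] by apply/funext => t; rewrite /tp big_nil.
by rewrite apply_op_tp.
Qed.

Lemma apply_op_sum (c : diffop R n N) (I : Type) (r : seq I) (x : I -> C) (f : I -> tfun R n) :
  (forall i, is_trigpoly (f i)) ->
  apply_op c (fun t => \sum_(i <- r) x i * f i t) =
  fun t => \sum_(i <- r) x i * apply_op c (f i) t.
Proof.
move=> tf; elim: r => [|i r IH].
  by under eq_fun do rewrite big_nil; rewrite apply_op0; apply/funext => t; rewrite big_nil.
under eq_fun do rewrite big_cons.
rewrite apply_op_lin //; last exact: trigpoly_sum.
by rewrite IH; apply/funext => t; rewrite big_cons.
Qed.

Lemma apply_op_mono (c : diffop R n N) xi t : apply_op c (mono xi) t = isymb c xi * mono xi t.
Proof.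
have -> : mono xi = tp [:: (xi, 1)] by apply/funext => u; rewrite /tp big_seq1 mul1r.
by rewrite apply_op_tp tp_scal /tp !big_seq1 mulr1 mul1r.
Qed.

Lemma trigpoly_bound f : is_trigpoly f -> exists B, forall t, cabs (f t) <= B.
Proof. by move=> [s ->]; exists (\sum_(p <- s) cabs p.2) => t; exact: cabs_tp. Qed.
End Trig.

(** * Norms, duals and biduals *)

Section SupNorms.
Variable R : realType.
Local Notation C := R[i].

(** The bound [B] certifies that the set is bounded; for an unbounded set [sup] would return its
    default value 0. *)
Lemma le_sup_cabs (A : Type) (D : set A) (F : A -> C) B a :
  (forall a, D a -> cabs (F a) <= B) -> D a ->
  cabs (F a) <= sup [set cabs (F a) | a in D].
Proof.
move=> hB Da; apply: ub_le_sup; last by exists a.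
by exists B => _ [b Db <-]; exact: hB.
Qed.

(** The condition [0 <= B] covers the empty set, whose [sup] is 0 by convention. *)
Lemma sup_cabs_le (A : Type) (D : set A) (F : A -> C) B : 0 <= B ->
  (forall a, D a -> cabs (F a) <= B) -> sup [set cabs (F a) | a in D] <= B.
Proof.
move=> B0 hB; have [->|/set0P [x Dx]] := eqVneq [set cabs (F a) | a in D] set0.
  by rewrite sup0.
by apply: ge_sup => [|_ [b Db <-]]; [exists x|exact: hB].
Qed.

Lemma sup_cabs_ge0 (A : Type) (D : set A) (F : A -> C) :
  0 <= sup [set cabs (F a) | a in D].
Proof.
have [[[y [a Da yE]] ub]|nosup] := pselect (has_sup [set cabs (F a) | a in D]).
  by rewrite (le_trans (cabs_ge0 (F a))) // ub_le_sup //; exists a.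
by rewrite sup_out.
Qed.
End SupNorms.

Section Norms.
Variable R : realType.
Local Notation C := R[i].
Variables (n N l : nat) (T : 'I_l -> diffop R n N).
Implicit Types (f g : tfun R n) (xi : 'I_n -> int) (phi : tfun R n -> C).
Local Notation nT := (normT T).

Lemma normT_ge0 f : 0 <= nT f. Proof. exact: bigmax_ge_id. Qed.

Lemma normT_ge f j t : is_trigpoly f -> cabs (apply_op (T j) f t) <= nT f.
Proof.
move=> tf; have [B hB] := trigpoly_bound (trigpoly_apply_op (T j) tf).
apply: le_trans (le_bigmax _ _ j).
exact: (@le_sup_cabs _ _ setT _ B).
Qed.

Lemma normT_le f B : 0 <= B -> (forall j t, cabs (apply_op (T j) f t) <= B) -> nT f <= B.
Proof. by move=> B0 hB; apply: bigmax_le => // j _; apply: sup_cabs_le. Qed.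

Lemma normT_lin (x : C) f g : is_trigpoly f -> is_trigpoly g ->
  nT (fun t => x * f t + g t) <= cabs x * nT f + nT g.
Proof.
move=> tf tg; apply: normT_le => [|j t].
  by rewrite addr_ge0 ?mulr_ge0 ?cabs_ge0 ?normT_ge0.
rewrite apply_op_lin // (le_trans (cabsD _ _)) // cabsM lerD ?normT_ge //.
by rewrite ler_wpM2l ?cabs_ge0 ?normT_ge.
Qed.

Lemma normT0 : nT (fun=> 0) = 0.
Proof.
apply/eqP; rewrite eq_le normT_ge0 andbT; apply: normT_le => // j t.
by rewrite apply_op0 cabs0.
Qed.

Lemma normTZ (x : C) f : is_trigpoly f -> nT (fun t => x * f t) <= cabs x * nT f.
Proof.
move=> tf; have := normT_lin x tf (@trigpoly0 R n).
by under eq_fun do rewrite addr0; rewrite normT0 addr0.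
Qed.

Lemma dualP phi : is_dual T phi -> exists2 M, 0 <= M &
  forall f, is_trigpoly f -> cabs (phi f) <= M * nT f.
Proof.
move=> [_ [M hM]]; exists `|M| => // f tf.
by rewrite (le_trans (hM _ tf)) // ler_wpM2r ?normT_ge0 ?ler_norm.
Qed.

Lemma dual0 phi : is_dual T phi -> phi (fun=> 0) = 0.
Proof.
move=> dphi; have [M _ /(_ _ (@trigpoly0 R n))] := dualP dphi.
by rewrite normT0 mulr0 => h; apply/eqP; rewrite -cabs_eq0 eq_le h cabs_ge0.
Qed.

Lemma dualZ phi (x : C) f : is_dual T phi -> is_trigpoly f ->
  phi (fun t => x * f t) = x * phi f.
Proof.
move=> dphi tf; have := dphi.1 x _ _ tf (@trigpoly0 R n).
by under eq_fun do rewrite addr0; rewrite dual0 // addr0.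
Qed.

Lemma dual_sum phi (I : Type) (r : seq I) (x : I -> C) (f : I -> tfun R n) :
  is_dual T phi -> (forall i, is_trigpoly (f i)) ->
  phi (fun t => \sum_(i <- r) x i * f i t) = \sum_(i <- r) x i * phi (f i).
Proof.
move=> dphi tf; elim: r => [|i r IH].
  by under eq_fun do rewrite big_nil; rewrite dual0 // big_nil.
under eq_fun do rewrite big_cons.
by rewrite dphi.1 ?big_cons ?IH //; exact: trigpoly_sum.
Qed.

Local Notation dn := (dnorm T).
Lemma dnormT_ge0 phi : 0 <= dn phi. Proof. exact: sup_cabs_ge0. Qed.

Lemma dnorm_le phi B : 0 <= B ->
  (forall f, is_trigpoly f -> cabs (phi f) <= B * nT f) -> dn phi <= B.
Proof.
move=> B0 hB; apply: sup_cabs_le => // f [tf nf].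
by rewrite (le_trans (hB _ tf)) // ler_piMr.
Qed.

Lemma dnorm_ge phi f : is_dual T phi -> is_trigpoly f -> cabs (phi f) <= dn phi * nT f.
Proof.
move=> dphi tf; have [M M0 hM] := dualP dphi.
(* [normT] is only a seminorm: on its null space boundedness forces [phi f] to vanish, elsewhere [f]
   is normalised. *)
have [n0|n0] := eqVneq (nT f) 0; first by have := hM _ tf; rewrite n0 !mulr0.
have np : 0 < nT f by rewrite lt_def n0 normT_ge0.
rewrite -ler_pdivrMr //.
have -> : cabs (phi f) / nT f = cabs (phi (fun t => ((nT f)^-1)%:C%C * f t)).
  by rewrite dualZ // cabsM cabs_real ger0_norm ?invr_ge0 ?ltW // mulrC.
apply: (@le_sup_cabs _ _ [set f | is_trigpoly f /\ nT f <= 1] phi M).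
  by move=> g [tg ng]; rewrite (le_trans (hM _ tg)) // ler_piMr.
split; first exact: trigpolyZ.
rewrite (le_trans (normTZ _ tf)) // cabs_real ger0_norm ?invr_ge0 ?(ltW np) //.
by rewrite mulVf.
Qed.

Lemma is_dual_lin (x : C) phi1 phi2 : is_dual T phi1 -> is_dual T phi2 ->
  is_dual T (fun f => x * phi1 f + phi2 f).
Proof.
move=> d1 d2; split => [y f g tf tg|].
  by rewrite d1.1 // d2.1 //; ring.
exists (cabs x * dn phi1 + dn phi2) => f tf.
rewrite (le_trans (cabsD _ _)) // cabsM mulrDl -mulrA.
by rewrite lerD ?ler_wpM2l ?cabs_ge0 ?dnorm_ge.
Qed.

Lemma is_dual0 : is_dual T (fun=> 0).
Proof. by split => [*|]; [rewrite mulr0 addr0|exists 0 => f _; rewrite cabs0 mul0r]. Qed.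

Lemma is_dual_sum (I : Type) (r : seq I) (x : I -> C) (phi : I -> tfun R n -> C) :
  (forall i, is_dual T (phi i)) -> is_dual T (fun f => \sum_(i <- r) x i * phi i f).
Proof.
move=> dphi; elim: r => [|i r IH].
  by under eq_fun do rewrite big_nil; exact: is_dual0.
by under eq_fun do rewrite big_cons; exact: is_dual_lin.
Qed.

Lemma dnorm_lin (x : C) phi1 phi2 : is_dual T phi1 -> is_dual T phi2 ->
  dn (fun f => x * phi1 f + phi2 f) <= cabs x * dn phi1 + dn phi2.
Proof.
move=> d1 d2; apply: dnorm_le => [|f tf].
  by rewrite addr_ge0 ?mulr_ge0 ?cabs_ge0 ?dnormT_ge0.
rewrite (le_trans (cabsD _ _)) // cabsM mulrDl -mulrA.
by rewrite lerD ?ler_wpM2l ?cabs_ge0 ?dnorm_ge.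
Qed.

Lemma dnorm0 : dn (fun=> 0) = 0.
Proof.
apply/eqP; rewrite eq_le dnormT_ge0 andbT dnorm_le // => f _.
by rewrite cabs0 mul0r.
Qed.

Implicit Types Psi : (tfun R n -> C) -> C.
Local Notation ddn := (ddnorm T).

Lemma bidualP Psi : is_bidual T Psi -> exists2 M, 0 <= M &
  forall phi, is_dual T phi -> cabs (Psi phi) <= M * dn phi.
Proof.
move=> [_ [M hM]]; exists `|M| => // f tf.
by rewrite (le_trans (hM _ tf)) // ler_wpM2r ?dnormT_ge0 ?ler_norm.
Qed.

Lemma bidual0 Psi : is_bidual T Psi -> Psi (fun=> 0) = 0.
Proof.
move=> dPsi; have [M _ /(_ _ is_dual0)] := bidualP dPsi.
by rewrite dnorm0 mulr0 => h; apply/eqP; rewrite -cabs_eq0 eq_le h cabs_ge0.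
Qed.

Lemma bidualZ Psi (x : C) phi : is_bidual T Psi -> is_dual T phi ->
  Psi (fun f => x * phi f) = x * Psi phi.
Proof.
move=> dPsi dphi; have := dPsi.1 x _ _ dphi is_dual0.
by under eq_fun do rewrite addr0; rewrite bidual0 // addr0.
Qed.

Lemma bidual_sum Psi (I : Type) (r : seq I) (x : I -> C) (phi : I -> tfun R n -> C) :
  is_bidual T Psi -> (forall i, is_dual T (phi i)) ->
  Psi (fun f => \sum_(i <- r) x i * phi i f) = \sum_(i <- r) x i * Psi (phi i).
Proof.
move=> dPsi dphi; elim: r => [|i r IH].
  by under eq_fun do rewrite big_nil; rewrite bidual0 // big_nil.
under eq_fun do rewrite big_cons.
by rewrite dPsi.1 ?big_cons ?IH //; exact: is_dual_sum.
Qed.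

(* Functionals are arbitrary functions off the trigonometric polynomials. *)
Lemma bidual_ext Psi phi1 phi2 : is_bidual T Psi -> is_dual T phi1 -> is_dual T phi2 ->
  (forall f, is_trigpoly f -> phi1 f = phi2 f) -> Psi phi1 = Psi phi2.
Proof.
move=> bP d1 d2 e; have [M M0 hM] := bidualP bP.
have dd := is_dual_lin (-1) d1 d2.
have h : dn (fun f => -1 * phi1 f + phi2 f) <= 0.
  by apply: dnorm_le => // f tf; rewrite e // mulN1r addNr cabs0 mul0r.
have := hM _ dd; rewrite bP.1 // mulN1r => h'.
apply/eqP; rewrite eq_sym -subr_eq0 -cabs_eq0 eq_le cabs_ge0 andbT addrC.
by rewrite (le_trans h') // mulr_ge0_le0.
Qed.

Lemma ddnorm_le Psi B : 0 <= B ->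
  (forall phi, is_dual T phi -> cabs (Psi phi) <= B * dn phi) -> ddn Psi <= B.
Proof.
move=> B0 hB; apply: sup_cabs_le => // f [tf nf].
by rewrite (le_trans (hB _ tf)) // ler_piMr.
Qed.

Lemma ddnorm_ge Psi phi : is_bidual T Psi -> is_dual T phi ->
  cabs (Psi phi) <= ddn Psi * dn phi.
Proof.
move=> dPsi dphi; have [M M0 hM] := bidualP dPsi.
have [n0|n0] := eqVneq (dn phi) 0; first by have := hM _ dphi; rewrite n0 !mulr0.
have np : 0 < dn phi by rewrite lt_def n0 dnormT_ge0.
rewrite -ler_pdivrMr //.
have -> : cabs (Psi phi) / dn phi = cabs (Psi (fun f => ((dn phi)^-1)%:C%C * phi f)).
  by rewrite bidualZ // cabsM cabs_real ger0_norm ?invr_ge0 ?ltW // mulrC.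
apply: (@le_sup_cabs _ _ [set phi | is_dual T phi /\ dn phi <= 1] Psi M).
  by move=> g [tg ng]; rewrite (le_trans (hM _ tg)) // ler_piMr.
split.
  have := is_dual_lin ((dn phi)^-1)%:C%C dphi is_dual0.
  by under eq_fun do rewrite addr0.
have := dnorm_lin ((dn phi)^-1)%:C%C dphi is_dual0.
under eq_fun do rewrite addr0.
rewrite dnorm0 addr0 cabs_real ger0_norm ?invr_ge0 ?(ltW np) //.
by rewrite mulVf.
Qed.

Lemma is_bidual_lin (x : C) Psi1 Psi2 : is_bidual T Psi1 -> is_bidual T Psi2 ->
  is_bidual T (fun phi => x * Psi1 phi + Psi2 phi).
Proof.
move=> d1 d2; split => [y f g tf tg|].
  by rewrite d1.1 // d2.1 //; ring.
exists (cabs x * ddn Psi1 + ddn Psi2) => f tf.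
rewrite (le_trans (cabsD _ _)) // cabsM mulrDl -mulrA.
by rewrite lerD ?ler_wpM2l ?cabs_ge0 ?ddnorm_ge.
Qed.

Lemma is_bidual0 : is_bidual T (fun=> 0).
Proof. by split => [*|]; [rewrite mulr0 addr0|exists 0 => f _; rewrite cabs0 mul0r]. Qed.

Lemma is_bidual_sum (I : Type) (r : seq I) (x : I -> C) (Psi : I -> (tfun R n -> C) -> C) :
  (forall i, is_bidual T (Psi i)) -> is_bidual T (fun phi => \sum_(i <- r) x i * Psi i phi).
Proof.
move=> dPsi; elim: r => [|i r IH].
  by under eq_fun do rewrite big_nil; exact: is_bidual0.
by under eq_fun do rewrite big_cons; exact: is_bidual_lin.
Qed.

(** The canonical embedding of trigonometric polynomials into the bidual. *)
Lemma is_bidual_eval f : is_trigpoly f -> is_bidual T (fun phi => phi f).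
Proof.
by move=> tf; split => //; exists (nT f) => phi dphi; rewrite mulrC dnorm_ge.
Qed.
End Norms.

(** * Fourier coefficients from grid averages *)

(** By $\cos 2u = 1 - 2\sin^2 u$ with $u = \pi x$, the value 1 would force $\sin \pi x = 0$, whereas
    $0 < \pi x < \pi$. *)
Lemma ee_neq1 (R : realType) (x : R) : 0 < x < 1 -> ee x != 1.
Proof.
move=> /andP[x0 x1]; apply/negP => /eqP /(congr1 (@complex.Re R)) /= h.
have : 0 < sin (pi * x).
  apply: sin_gt0_pi; rewrite ?mulr_gt0 ?pi_gt0 // -[ltRHS]mulr1.
  by rewrite ltr_pM2l ?pi_gt0.
have e : cos (2 * pi * x) = 1 - sin (pi * x) ^+ 2 *+ 2.
  rewrite (_ : 2 * pi * x = pi * x + pi * x) ?cosD; last by ring.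
  by rewrite -!expr2 -(cos2Dsin2 (pi * x)); ring.
move: h; rewrite e => /eqP; rewrite -subr_eq0 addrAC subrr add0r oppr_eq0.
by rewrite mulrn_eq0 /= sqrf_eq0 => /eqP ->; rewrite ltxx.
Qed.

Section Grid.
Variable R : realType.
Local Notation C := R[i].
Variable n : nat.
Implicit Types (f g : tfun R n) (xi : 'I_n -> int) (s : seq (('I_n -> int) * C)).

Definition gp D (y : {ffun 'I_n -> 'I_D}) : 'I_n -> R := fun k => (y k)%:R / D%:R.
(** Grid averages stand in for the integral over the torus: they are finite sums, and exact on a
    trigonometric polynomial once [D] exceeds the size of its frequencies. The field [K] is complex
    for Fourier coefficients and real for $L^1$ norms. *)
Definition gavg (K : numFieldType) D (F : ('I_n -> R) -> K) : K :=
  ((D ^ n)%N%:R)^-1 * \sum_(y : {ffun 'I_n -> 'I_D}) F (gp y).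

Lemma gavg_lin D (x : C) f g :
  gavg D (fun t => x * f t + g t) = x * gavg D f + gavg D g.
Proof. by rewrite /gavg big_split /= -mulr_sumr mulrDr mulrCA. Qed.

Lemma gavg_sum D (I : Type) (r : seq I) (x : I -> C) (f : I -> tfun R n) :
  gavg D (fun t => \sum_(i <- r) x i * f i t) = \sum_(i <- r) x i * gavg D (f i).
Proof.
rewrite /gavg exchange_big /= mulr_sumr; apply: eq_bigr => i _.
by rewrite -mulr_sumr mulrCA.
Qed.

Lemma cabs_nat m : cabs (m%:R : C) = m%:R.
Proof. by rewrite -(rmorph_nat (@real_complex R)) cabs_real ger0_norm. Qed.

Lemma cabs_gavg D f : cabs (gavg D f) <= gavg D (fun t => cabs (f t)).
Proof. by rewrite /gavg cabsM cabsV cabs_nat ler_wpM2l ?invr_ge0 ?cabs_sum. Qed.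

Lemma gavg_le D (F G : ('I_n -> R) -> R) : (forall t, F t <= G t) -> gavg D F <= gavg D G.
Proof. by move=> h; rewrite /gavg ler_wpM2l ?invr_ge0 // ler_sum. Qed.

Lemma gavg_cst D (c : R) : (0 < D)%N -> gavg D (fun=> c) = c.
Proof.
move=> D0; rewrite /gavg sumr_const card_ffun !card_ord -[c *+ _]mulr_natl mulKf //.
by rewrite pnatr_eq0 expn_eq0 negb_and -lt0n D0.
Qed.

Lemma gavgZ D (c : R) F : gavg D (fun t => c * F t) = c * gavg D F.
Proof. by rewrite /gavg -mulr_sumr mulrCA. Qed.

Lemma gavg_rsum D (I : Type) (r : seq I) (F : I -> ('I_n -> R) -> R) :
  gavg D (fun t => \sum_(i <- r) F i t) = \sum_(i <- r) gavg D (F i).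
Proof. by rewrite /gavg exchange_big mulr_sumr. Qed.

(** The sum factors over the coordinates into geometric sums of $D$-th roots of unity. A nonzero
    frequency smaller than [D] gives a root different from 1, hence a vanishing factor; larger
    frequencies could alias to 0. *)
Lemma gavg_mono D xi : (forall k, (absz (xi k) < D)%N) -> (0 < D)%N ->
  gavg D (mono xi) = [forall k, xi k == 0]%:R.
Proof.
move=> hD D0; have Dn0 : (D%:R : R) != 0 by rewrite pnatr_eq0 -lt0n.
have Dc0 : (D%:R : C) != 0 by rewrite pnatr_eq0 -lt0n.
pose z k : C := ee ((xi k)%:~R / D%:R).
have e (y : {ffun 'I_n -> 'I_D}) : mono xi (gp y) = \prod_k z k ^+ y k.
  rewrite /mono (big_morph _ (@eeD R) (@ee0 R)); apply: eq_bigr => k _.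
  by rewrite /z -eeMn /gp; congr ee; ring.
rewrite /gavg; under eq_bigr => y _ do rewrite e.
rewrite -(bigA_distr_bigA (fun k (y : 'I_D) => z k ^+ y)) /=.
have [/forallP h|/forallPn [k hk]] := boolP [forall k, xi k == 0].
  under eq_bigr => k _.
    under eq_bigr => i _ do rewrite /z (eqP (h k)) mul0r ee0 expr1n.
    rewrite sumr_const card_ord; over.
  rewrite prodr_const card_ord natrX mulVf // expf_neq0 //.
suff /eqP z0 : \sum_(i < D) z k ^+ i == 0.
  by rewrite (bigD1 k) //= z0 mul0r mulr0.
have z1 : z k != 1.
  rewrite /z; case: (xi k) (hD k) hk => m /= mD m0.
    rewrite -pmulrn; apply: ee_neq1; apply/andP; split.
      by rewrite divr_gt0 ?ltr0n // lt0n; exact: m0.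
    by rewrite ltr_pdivrMr ?ltr0n // mul1r ltr_nat.
  rewrite NegzE mulrNz mulNr; apply/eqP => h.
  have := eeN_mul (m.+1%:~R / D%:R : R); rewrite h mul1r; apply/eqP/ee_neq1.
  rewrite -pmulrn; apply/andP; split; first by rewrite divr_gt0 ?ltr0n.
  by rewrite ltr_pdivrMr ?ltr0n // mul1r ltr_nat.
have := subrX1 (z k) D; rewrite /z -eeMn mulrCA divff // mulr1 ee_int subrr -/(z k).
move=> /esym/eqP; rewrite mulf_eq0 subr_eq0 (negbTE z1) /=.
by under eq_bigr => i _ do rewrite -[_ ^+ i]/(z k ^+ i).
Qed.

Definition opp_freq xi : 'I_n -> int := fun k => - xi k.

Lemma monoD xi eta (t : 'I_n -> R) : mono xi t * mono eta t = mono (fun k => xi k + eta k) t.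
Proof.
rewrite /mono -eeD -big_split /=; congr ee; apply: eq_bigr => k _.
by rewrite -mulrDl intrD.
Qed.

Lemma mono_sub xi (t u : 'I_n -> R) : mono xi (fun k => t k - u k) = mono xi t * mono (opp_freq xi) u.
Proof.
rewrite /mono -eeD -big_split /=; congr ee; apply: eq_bigr => k _.
by rewrite /opp_freq mulrBr mulrNz mulNr.
Qed.

Definition tcoef xi s : C := \sum_(p <- s | [forall k, p.1 k == xi k]) p.2.

(** Multiplication by the opposite mode moves the frequency [xi] to 0, so the average is exact as
    soon as [D] exceeds every difference between a frequency of [s] and [xi]. *)
Lemma tcoefP xi s : exists D0, forall D, (D0 <= D)%N ->
  gavg D (fun t => tp s t * mono (opp_freq xi) t) = tcoef xi s.
Proof.
elim: s => [|p s [D1 IH]].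
  exists 0%N => D _; rewrite /tcoef big_nil /gavg big1 ?mulr0 // => y _.
  by rewrite /tp big_nil mul0r.
exists (maxn D1 (\max_(k < n) (absz (p.1 k - xi k)).+1).+1) => D.
rewrite geq_max => /andP[D1D hD].
have -> : (fun t => tp (p :: s) t * mono (opp_freq xi) t) = fun t =>
   p.2 * mono (fun k => p.1 k + opp_freq xi k) t + tp s t * mono (opp_freq xi) t.
  by apply/funext => t; rewrite tp_cons mulrDl -mulrA monoD.
rewrite gavg_lin IH // gavg_mono; last 2 first.
- move=> k; apply: leq_trans (ltnW hD).
  exact: (@leq_bigmax _ (fun k => (absz (p.1 k - xi k)).+1) k).
- exact: leq_trans hD.
have -> : [forall k, p.1 k + opp_freq xi k == 0] = [forall k, p.1 k == xi k].
  by apply: eq_forallb => k; rewrite /opp_freq subr_eq0.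
by rewrite /tcoef big_cons; case: ifP => _; rewrite ?mulr1 // mulr0 add0r.
Qed.

(* The Fourier coefficient: averages over fine grids are eventually constant. *)
Definition hatc xi f : C := xget 0 [set c | exists D0, forall D, (D0 <= D)%N ->
  gavg D (fun t => f t * mono (opp_freq xi) t) = c].

Lemma hatcP xi f : is_trigpoly f -> exists D0, forall D, (D0 <= D)%N ->
  gavg D (fun t => f t * mono (opp_freq xi) t) = hatc xi f.
Proof.
move=> [s ->]; have [D0 h] := tcoefP xi s.
by rewrite /hatc; case: xgetP => [_ -> // | /(_ (tcoef xi s))[]]; exists D0.
Qed.

Lemma hatc_tp xi s : hatc xi (tp s) = tcoef xi s.
Proof.
have [D1 h1] := @hatcP xi (tp s) (ex_intro _ s erefl); have [D0 h0] := tcoefP xi s.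
by rewrite -(h1 (maxn D0 D1)) ?leq_maxr // h0 // leq_maxl.
Qed.

Lemma hatc_lin xi (x : C) f g : is_trigpoly f -> is_trigpoly g ->
  hatc xi (fun t => x * f t + g t) = x * hatc xi f + hatc xi g.
Proof.
move=> [s ->] [s' ->]; rewrite -!/(tp _) tp_lin !hatc_tp /tcoef big_cat /= big_map.
by rewrite mulr_sumr.
Qed.

Lemma hatc_mono xi : hatc xi (mono xi) = 1.
Proof.
have -> : mono xi = tp [:: (xi, 1 : C)] by apply/funext => u; rewrite /tp big_seq1 mul1r.
rewrite hatc_tp /tcoef big_cons big_nil /= addr0.
by have -> : [forall k, xi k == xi k] by apply/forallP.
Qed.

Variable N : nat.

Lemma hatc_apply_op (c : diffop R n N) xi f : is_trigpoly f ->
  hatc xi (apply_op c f) = isymb c xi * hatc xi f.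
Proof.
move=> [s ->]; rewrite -/(tp s) apply_op_tp !hatc_tp /tcoef big_map /= mulr_sumr.
apply: eq_bigr => p /forallP h; congr (isymb c _ * _).
by apply/funext => k; apply/eqP.
Qed.

Lemma hatc_le xi f : is_trigpoly f -> exists D0, forall D, (D0 <= D)%N ->
  cabs (hatc xi f) <= gavg D (fun t => cabs (f t)).
Proof.
move=> tf; have [D0 h] := hatcP xi tf; exists D0 => D DD; rewrite -(h _ DD).
rewrite (le_trans (cabs_gavg _ _)) // gavg_le // => t.
by rewrite cabsM cabs_mono mulr1.
Qed.

(** Where the symbol of [T j] does not vanish, the coefficient of [f] is recovered by division from
    that of [T j f], which is at most the sup norm of [T j f]. *)
Lemma is_dual_hatc l (T : 'I_l -> diffop R n N) xi j :
  isymb (T j) xi != 0 -> is_dual T (hatc xi).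
Proof.
move=> h; split; first by move=> *; exact: hatc_lin.
have s0 : 0 < cabs (isymb (T j) xi) by rewrite cabs_gt0.
exists (cabs (isymb (T j) xi))^-1 => f tf; rewrite ler_pdivlMl // -cabsM -hatc_apply_op //.
have [D0 hD] := hatc_le xi (trigpoly_apply_op (T j) tf).
rewrite (le_trans (hD D0.+1 (leqnSn _))) // -[leRHS](@gavg_cst D0.+1) // gavg_le // => t.
exact: normT_ge.
Qed.
End Grid.

(** * The Hahn-Banach theorem *)

Section HahnBanach.
Variables (R : realType) (V : lmodType R) (D : set V) (p : V -> R).
Hypothesis D_lin : forall c v w, D v -> D w -> D (c *: v + w).
Hypothesis p_add : forall v w, D v -> D w -> p (v + w) <= p v + p w.
Hypothesis p_scale : forall c v, 0 <= c -> D v -> p (c *: v) <= c * p v.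

(* Graphs of linear functionals on subspaces of [D] dominated by [p]. *)
Definition good_graph (G : set (V * R)) :=
  (forall c u w, G u -> G w -> G (c *: u.1 + w.1, c * u.2 + w.2)) /\
  (forall u, G u -> D u.1 /\ u.2 <= p u.1).

Lemma good_graph0 G u : good_graph G -> G u -> G (0, 0).
Proof. by move=> [h _] Gu; have := h (-1) _ _ Gu Gu; rewrite scaleN1r mulN1r !addNr. Qed.

Lemma good_graph_scale G c u : good_graph G -> G u -> G (c *: u.1, c * u.2).
Proof.
move=> gG Gu; have := gG.1 c _ _ Gu (good_graph0 gG Gu).
by rewrite !addr0.
Qed.

(** Two values at the same [v] put $(0, r-s)$ and $(0, s-r)$ into the graph; domination by [p], with
    $p(0)\le 0$, makes both differences nonpositive. *)
Lemma good_graph_fun G v r s : good_graph G -> G (v, r) -> G (v, s) -> r = s.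
Proof.
have p0 v' : D v' -> p 0 <= 0 by move=> Dv; have := p_scale (lexx 0) Dv; rewrite scale0r mul0r.
move=> gG Gr Gs; have [Dv _] := gG.2 _ Gr.
have := (gG.2 _ (gG.1 (-1) _ _ Gr Gs)).2; have := (gG.2 _ (gG.1 (-1) _ _ Gs Gr)).2.
rewrite /= scaleN1r addNr; have := p0 _ Dv; lra.
Qed.

Lemma good_graph_extend G u v : good_graph G -> G u -> D v ->
  exists2 G', good_graph G' & G `<=` G' /\ exists r, G' (v, r).
Proof.
move=> gG Gu Dv; have [Glin Gp] := gG.
have G0 := good_graph0 gG Gu.
(* Writing $g$ for the functional with graph [G], an admissible value at [v] lies above all
   $g(w)-p(w-v)$ and below all $p(w+v)-g(w)$. The supremum of the lower bounds is chosen. *)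
pose S := [set w.2 - p (w.1 - v) | w in G].
have DB w : G w -> D (w.1 - v).
  by move=> /Gp[Dw _]; rewrite addrC -scaleN1r; exact: D_lin.
have DD w : G w -> D (w.1 + v).
  by move=> /Gp[Dw _]; rewrite -[w.1]scale1r; exact: D_lin.
have S_le w w' : G w -> G w' -> w.2 - p (w.1 - v) <= p (w'.1 + v) - w'.2.
  move=> Gw Gw'; have [_ ] := Gp _ (Glin 1 _ _ Gw Gw'); rewrite /= scale1r mul1r.
  have := p_add (DB _ Gw) (DD _ Gw'); rewrite addrACA addNr addr0; lra.
have r_le w : G w -> sup S <= p (w.1 + v) - w.2.
  move=> Gw; apply: ge_sup => [|_ [w' Gw' <-]]; last exact: S_le.
  by exists (u.2 - p (u.1 - v)); exists u.
have r_ge w : G w -> w.2 - p (w.1 - v) <= sup S.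
  move=> Gw; apply: ub_le_sup; last by exists w.
  by exists (p (u.1 + v) - u.2) => _ [w' Gw' <-]; exact: S_le.
exists [set w | exists2 x, G x & exists c, w = (x.1 + c *: v, x.2 + c * sup S)].
  split.
    move=> c _ _ [x Gx [d ->]] [y Gy [e ->]] /=.
    exists (c *: x.1 + y.1, c * x.2 + y.2); first exact: Glin.
    exists (c * d + e) => /=; rewrite scalerDr scalerDl scalerA addrACA.
    by congr pair; ring.
  move=> _ [x Gx [c ->]] /=; have Dxc : D (x.1 + c *: v).
    by rewrite addrC; apply: D_lin => //; case: (Gp _ Gx).
  split => //; have [c0|c0|<-] := ltgtP 0 c.
  - have := r_le _ (good_graph_scale c^-1 gG Gx).
    have := p_scale (_ : 0 <= c^-1) Dxc.
    rewrite invr_ge0 (ltW c0) => /(_ isT) /=.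
    rewrite scalerDr scalerA mulVf ?gt_eqF // scale1r => h1 h2.
    have : sup S <= c^-1 * (p (x.1 + c *: v) - x.2) by rewrite mulrBr (le_trans h2) // lerB.
    by rewrite ler_pdivlMl // => h; lra.
  - have cp : 0 < - c by rewrite oppr_gt0.
    have := r_ge _ (good_graph_scale (- c)^-1 gG Gx).
    have := p_scale (_ : 0 <= (- c)^-1) Dxc.
    rewrite invr_ge0 (ltW cp) => /(_ isT) /=.
    rewrite scalerDr scalerA invrN mulNr mulVf ?lt_eqF // scaleN1r => h1 h2.
    have : (- c)^-1 * (x.2 - p (x.1 + c *: v)) <= sup S.
      by rewrite mulrBr invrN (le_trans _ h2) // lerB.
    by rewrite ler_pdivrMl // => h; lra.
  - by rewrite scale0r addr0 mul0r addr0; case: (Gp _ Gx).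
split; last by exists (sup S); exists (0, 0) => //; exists 1; rewrite /= !add0r scale1r mul1r.
by move=> x Gx; exists x => //; exists 0; rewrite scale0r mul0r !addr0; case: (x).
Qed.

Lemma hahn_banach (G0 : set (V * R)) u0 : G0 u0 -> good_graph G0 ->
  exists rho : V -> R,
  [/\ forall c v w, D v -> D w -> rho (c *: v + w) = c * rho v + rho w,
      forall v, D v -> rho v <= p v & forall u, G0 u -> rho u.1 = u.2].
Proof.
(* Zorn's lemma is applied to sets whose union with [G0] is good, so that the union of the empty
   chain qualifies as well. *)
move=> G0u gG0; pose P G := good_graph (G `|` G0).
have [F FP totF|A [PA maxA]] := @Zorn_bigcup _ P.
  have cov u w : (\bigcup_(X in F) X `|` G0) u -> (\bigcup_(X in F) X `|` G0) w ->
    exists2 X, good_graph X & [/\ X u, X w & X `<=` \bigcup_(X in F) X `|` G0].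
    have sub X : F X -> X `|` G0 `<=` \bigcup_(X in F) X `|` G0.
      by move=> FX z [Xz|]; [left; exists X|right].
    move=> [[X FX Xu]|G0u'] [[Y FY Yw]|G0w].
    - have [XY|YX] := totF _ _ FX FY.
        by exists (Y `|` G0); [exact: FP|split; [left; exact: XY|left|exact: sub]].
      by exists (X `|` G0); [exact: FP|split; [left|left; exact: YX|exact: sub]].
    - by exists (X `|` G0); [exact: FP|split; [left|right|exact: sub]].
    - by exists (Y `|` G0); [exact: FP|split; [right|left|exact: sub]].
    - by exists G0 => //; split => // z; right.
  split=> [c u w hu hw|u hu].
    by have [X gX [Xu Xw Xs]] := cov _ _ hu hw; apply: Xs; exact: gX.1.
  by have [X gX [Xu _ _]] := cov _ _ hu hu; exact: gX.2.
have full v : D v -> exists r, (A `|` G0) (v, r).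
  move=> Dv; apply: contrapT => nr.
  have [G' gG' [sG' [r G'r]]] := good_graph_extend PA (or_intror G0u) Dv.
  apply: (maxA G').
    split; first by move=> z Az; apply: sG'; left.
    by move=> G'A; apply: nr; exists r; left; exact: G'A.
  suff : G' `|` G0 = G' by rewrite /P => ->.
  by apply/seteqP; split => [z [//|G0z]|z]; [apply: sG'; right|left].
have /choice [rho hrho] : forall v, exists r, D v -> (A `|` G0) (v, r).
  by move=> v; have [/full[r]|] := pselect (D v); [exists r|exists 0].
exists rho; split.
- move=> c v w Dv Dw; apply: (good_graph_fun PA (hrho _ (D_lin c Dv Dw))).
  exact: (PA.1 c (v, rho v) (w, rho w) (hrho _ Dv) (hrho _ Dw)).
- by move=> v Dv; have [] := PA.2 _ (hrho _ Dv).
- move=> [v r] hu; apply: (good_graph_fun PA (hrho _ _)); last by right.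
  by case: (gG0.2 _ hu).
Qed.
End HahnBanach.

(** * Functionals dominated by signed sums *)

Section SignDecomposition.
Variable R : realType.
Local Notation C := R[i].
Variables (n N l : nat) (T : 'I_l -> diffop R n N).
Local Notation nT := (normT T).
Local Notation dn := (dnorm T).
Variable m : nat.
Local Notation E := {ffun 'I_m -> bool}.

Definition sgn (e : E) (k : 'I_m) : C := (-1) ^+ e k.

Lemma cabs_sgn e k : cabs (sgn e k) = 1.
Proof. by rewrite /sgn cabsX cabsN cabs1 expr1n. Qed.

Lemma cabs_rotate (z : C) : exists2 u, cabs u <= 1 & u * z = (cabs z)%:C%C.
Proof.
have [->|z0] := eqVneq z 0; first by exists 0; rewrite ?cabs0 ?mulr0.
exists ((cabs z)%:C%C / z); last by rewrite divfK.
by rewrite cabsM cabsV cabs_real ger0_norm ?cabs_ge0 // divff // cabs_eq0.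
Qed.

(** Families indexed by sign patterns form a real vector space through [Rcomplex], because the
    Hahn-Banach theorem above is real; complex linearity is restored afterwards. *)
Local Notation V := (E -> ('I_n -> R) -> Rcomplex R).
Let D : set V := [set w | forall e, is_trigpoly (w e)].

Let D_lin c v w : D v -> D w -> D (c *: v + w).
Proof.
move=> Dv Dw e; have := trigpoly_lin (c%:C%C) (Dv e) (Dw e).
congr is_trigpoly; apply/funext => t.
by rewrite -[RHS]/(c *: v e t + w e t); congr (_ + _); case: (v e t) => a b; simpc.
Qed.

Variable B : R.
Hypothesis B_ge0 : 0 <= B.
Let p (w : V) := B * \big[Num.max/0]_e nT (w e).

Let p_add v w : D v -> D w -> p (v + w) <= p v + p w.
Proof.
move=> Dv Dw; rewrite -mulrDr ler_wpM2l //; apply: bigmax_le => [|e _].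
  by rewrite addr_ge0 ?bigmax_ge_id.
have := normT_lin T 1 (Dv e) (Dw e); under eq_fun do rewrite mul1r.
rewrite cabs1 mul1r => /le_trans; apply.
by rewrite lerD ?(le_bigmax _ (fun e => nT (_ e))).
Qed.

Let p_scale c v : 0 <= c -> D v -> p (c *: v) <= c * p v.
Proof.
move=> c0 Dv; rewrite mulrCA ler_wpM2l //; apply: bigmax_le => [|e _].
  by rewrite mulr_ge0 ?bigmax_ge_id.
have := normTZ T c%:C%C (Dv e); rewrite cabs_real ger0_norm // => h.
apply: (@le_trans _ _ (c * nT (v e))); last by rewrite ler_wpM2l ?(le_bigmax _ (fun e => nT (_ e))).
move: h; congr (normT T _ <= _); apply/funext => t.
by rewrite -[RHS]/(c *: v e t); case: (v e t) => a b; simpc.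
Qed.

Variable omega : 'I_m -> tfun R n -> C.
Hypothesis omega_dual : forall k, is_dual T (omega k).
Hypothesis omega_le : forall x : 'I_m -> tfun R n, (forall k, is_trigpoly (x k)) ->
  cabs (\sum_k omega k (x k)) <=
  B * \big[Num.max/0]_(e : E) nT (fun t => \sum_k sgn e k * x k t).

Let signs (x : 'I_m -> tfun R n) : V := fun e t => \sum_k sgn e k * x k t.
Let G0 : set (V * R) := [set u | exists2 x, (forall k, is_trigpoly (x k)) &
  u = (signs x, complex.Re (\sum_k omega k (x k)))].

Let G0_good : good_graph D p G0.
Proof.
split=> [c _ _ [x tx ->] [y ty ->]|_ [x tx ->]] /=.
  exists (fun k t => c%:C%C * x k t + y k t); first by move=> k; exact: trigpoly_lin.
  congr pair.
    apply/funext => e; apply/funext => t.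
    rewrite -[LHS]/(c *: signs x e t + signs y e t) /signs.
    have -> : c *: ((\sum_k sgn e k * x k t) : Rcomplex R) = c%:C%C * \sum_k sgn e k * x k t.
      by case: (\sum_k _) => a b; simpc.
    by rewrite mulr_sumr -big_split; apply: eq_bigr => k _ /=; ring.
  under [in RHS]eq_bigr => k _ do rewrite (omega_dual k).1 //.
  rewrite big_split /= -mulr_sumr raddfD /=; congr (_ + _).
  by case: (\sum_k _) => a b /=; rewrite mul0r subr0.
split; first by move=> e; exact: trigpoly_sum.
apply: le_trans (omega_le tx); apply: le_trans (Re_le_cabs _); exact: ler_norm.
Qed.

(** Hahn-Banach extends the real part of $\sum_k\omega_k(x_k)$ from the families of signed sums to
    all families $(w_e)$, keeping the bound $B\max_e\|w_e\|_T$. The extension splits into components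
    [theta e]; as the dual of a maximum norm is a sum norm, their norms add up to at most [B].
    Tuples with a single nonzero entry recover each [omega k]. *)
Lemma sign_decomposition : exists theta : E -> tfun R n -> C,
  [/\ forall e, is_dual T (theta e),
      forall k f, is_trigpoly f -> omega k f = \sum_e sgn e k * theta e f &
      \sum_e dn (theta e) <= B].
Proof.
have G00 : G0 (signs (fun _ _ => 0), 0).
  exists (fun _ _ => 0); first by move=> k; exact: trigpoly0.
  by rewrite big1 // => k _; exact: dual0.
have [rho [rho_lin rho_le rho_G0]] := hahn_banach D_lin p_add p_scale G00 G0_good.
pose at_ e (f : tfun R n) : V := fun e' => if e' == e then f else fun=> 0.
have D_at e f : is_trigpoly f -> D (at_ e f).
  by move=> tf e'; rewrite /at_; case: ifP => // _; exact: trigpoly0.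
pose S e f := rho (at_ e f).
have SE e (c : R) f g : is_trigpoly f -> is_trigpoly g ->
    S e (fun t => c%:C%C * f t + g t) = c * S e f + S e g.
  move=> tf tg; rewrite -rho_lin; [|exact: D_at..]; congr rho.
  apply/funext => e'; apply/funext => t.
  rewrite -[RHS]/(c *: at_ e f e' t + at_ e g e' t) /at_; case: ifP => _.
    by congr (_ + _); case: (f t) => a b; simpc.
  by rewrite scaler0 addr0.
have tiZ (f : tfun R n) : is_trigpoly f -> is_trigpoly (fun t => 'i%C * f t) by exact: trigpolyZ.
(* The complex linear functional whose real part is [S e]. *)
pose theta e f : C := Complex (S e f) (- S e (fun t => 'i%C * f t)).
have theta_lin e (x : C) f g : is_trigpoly f -> is_trigpoly g ->
    theta e (fun t => x * f t + g t) = x * theta e f + theta e g.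
  case: x => a b tf tg; rewrite /theta.
  have -> : (fun t => Complex a b * f t + g t) =
      (fun t => a%:C%C * f t + (b%:C%C * ('i%C * f t) + g t)).
    apply/funext => t; rewrite addrA; congr (_ + _).
    by rewrite mulrA -mulrDl; congr (_ * _); simpc.
  have -> : (fun t => 'i%C * (Complex a b * f t + g t)) =
      (fun t => a%:C%C * ('i%C * f t) + ((- b)%:C%C * f t + 'i%C * g t)).
    apply/funext => t; rewrite mulrDr addrA; congr (_ + _).
    by rewrite !mulrA -mulrDl; congr (_ * _); simpc.
  have tif := tiZ _ tf; have tig := tiZ _ tg.
  have t1 := trigpoly_lin b%:C%C tif tg; have t2 := trigpoly_lin (- b)%:C%C tf tig.
  rewrite !SE //.
  by simpc; congr Complex; ring.
have thetaZ e (x : C) f : is_trigpoly f -> theta e (fun t => x * f t) = x * theta e f.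
  move=> tf; have h0 : theta e (fun=> 0) = 0.
    have := theta_lin e (-1) _ _ (@trigpoly0 R n) (@trigpoly0 R n).
    by rewrite !(mulN1r, addNr).
  have := theta_lin e x _ _ tf (@trigpoly0 R n); rewrite h0 addr0.
  by under eq_fun do rewrite addr0.
have rho0 : rho 0 = 0.
  have D0 : D 0 by move=> e; exact: trigpoly0.
  by have := rho_lin (-1) _ _ D0 D0; rewrite scaler0 addr0 mulN1r addNr.
have rho_sum w : D w -> rho w = \sum_e S e (w e).
  move=> Dw; transitivity (rho (\sum_e at_ e (w e))).
    congr rho; apply/funext => e'; rewrite fct_sumE (bigD1 e') //= /at_ eqxx.
    by rewrite big1 ?addr0 // => e /negbTE; rewrite eq_sym => ->.
  suff [] : rho (\sum_e at_ e (w e)) = \sum_e S e (w e) /\ D (\sum_e at_ e (w e)) by [].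
  elim/big_rec2: _ => [|e y v _ [IH Dv]].
    by split => // e; exact: trigpoly0.
  have De := D_at e _ (Dw e).
  split; first by have := rho_lin 1 _ _ De Dv; rewrite scale1r mul1r IH.
  by have := D_lin 1 De Dv; rewrite scale1r.
have theta_sum w : D w -> \sum_e theta e (w e) =
     Complex (rho w) (- rho (fun e t => 'i%C * w e t)).
  move=> Dw; rewrite rho_sum // [rho (fun _ => _)]rho_sum; last by move=> e; exact: tiZ.
  rewrite -sumrN; apply/eqP; rewrite eq_complex /= !raddf_sum /=.
  by rewrite !eqxx.
have norm_le w : D w -> \sum_e cabs (theta e (w e)) <= p w.
  (* Rotation by [u e] makes all the values [theta e (w e)] nonnegative at once without increasing
     the maximum norm, so a single value of [rho] bounds the whole sum. *)
  move=> Dw; have /choice[u hu] : forall e, exists u, cabs u <= 1 /\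
      u * theta e (w e) = (cabs (theta e (w e)))%:C%C.
    by move=> e; have [u] := cabs_rotate (theta e (w e)); exists u.
  have Du : D (fun e t => u e * w e t) by move=> e; exact: trigpolyZ.
  apply: (@le_trans _ _ (rho (fun e t => u e * w e t))).
    rewrite rho_sum // ler_sum // => e _.
    rewrite -[S e _]/(complex.Re (theta e (fun t => u e * w e t))).
    by rewrite thetaZ // (hu e).2.
  rewrite (le_trans (rho_le _ Du)) // ler_wpM2l //.
  apply: bigmax_le => [|e _]; first exact: bigmax_ge_id.
  rewrite (le_trans (normTZ _ _ (Dw e))) //.
  rewrite (le_trans _ (le_bigmax _ (fun e => nT (w e)) e)) //.
  by rewrite ler_piMl ?normT_ge0 ?(hu e).1.
have theta_dual e : is_dual T (theta e).
  split; first by move=> *; exact: theta_lin.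
  exists B => f tf; apply: (@le_trans _ _ (p (at_ e f))).
    apply: le_trans (norm_le _ (D_at e _ tf)).
    rewrite (bigD1 e) //= /at_ eqxx lerDl sumr_ge0 // => *; exact: cabs_ge0.
  rewrite ler_wpM2l //; apply: bigmax_le => [|e' _]; first exact: normT_ge0.
  by rewrite /at_; case: ifP => // _; rewrite normT0 normT_ge0.
exists theta; split => //.
  move=> k f tf; pose x k' : tfun R n := if k' == k then f else fun=> 0.
  have sE e : (fun t => \sum_k' sgn e k' * x k' t) = fun t => sgn e k * f t.
    apply/funext => t; rewrite (bigD1 k) //= /x eqxx big1 ?addr0 // => k' /negbTE ->.
    by rewrite mulr0.
  have tx k' : is_trigpoly (x k') by rewrite /x; case: ifP => // _; exact: trigpoly0.
  have oE : \sum_k' omega k' (x k') = omega k f.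
    rewrite (bigD1 k) //= /x eqxx big1 ?addr0 // => k' /negbTE ->; exact: dual0.
  have oiE : \sum_k' omega k' (fun t => 'i%C * x k' t) = 'i%C * omega k f.
    by rewrite -oE mulr_sumr; apply: eq_bigr => k' _; rewrite (dualZ _ (omega_dual _)).
  have Dx : D (signs x) by move=> e; exact: trigpoly_sum.
  transitivity (\sum_e theta e (signs x e)); last first.
    by apply: eq_bigr => e _; rewrite /signs sE thetaZ.
  rewrite theta_sum //.
  have -> : (fun e t => 'i%C * signs x e t) = signs (fun k t => 'i%C * x k t).
    apply/funext => e; apply/funext => t; rewrite /signs mulr_sumr.
    by apply: eq_bigr => k' _; rewrite mulrCA.
  have rhoG y : (forall k, is_trigpoly (y k)) ->
      rho (signs y) = complex.Re (\sum_k omega k (y k)).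
    by move=> ty; apply: (rho_G0 (signs y, complex.Re (\sum_k omega k (y k)))); exists y.
  rewrite !rhoG //; last by move=> k'; exact: tiZ.
  by rewrite oE oiE; case: (omega k f) => a b; simpc.
(* Near-maximisers are taken for all [e] simultaneously, each losing at most $d/(|E|+1)$, so that
   the total loss is at most [d]. *)
apply/ler_addgt0Pr => d d0.
have d'0 : 0 < d / #|E|.+1%:R by rewrite divr_gt0.
have /choice[w hw] : forall e, exists f, [/\ is_trigpoly f, nT f <= 1 &
    dn (theta e) - d / #|E|.+1%:R <= cabs (theta e f)].
  move=> e; have [|_ [f [tf nf] <-] h] := @sup_adherent _ [set cabs (theta e f) |
     f in [set f | is_trigpoly f /\ nT f <= 1]] _ d'0.
    split.
      exists (cabs (theta e (fun=> 0))), (fun=> 0) => //.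
      by split; [exact: trigpoly0|rewrite normT0].
    exists (dn (theta e)) => _ [f [tf nf] <-].
    apply: le_trans (dnorm_ge (theta_dual e) tf) _.
    by apply: ler_piMr => //; exact: dnormT_ge0.
  by exists f; split => //; exact: ltW.
have Dw : D w by move=> e; case: (hw e).
apply: (@le_trans _ _ (\sum_e (cabs (theta e (w e)) + d / #|E|.+1%:R))).
  by apply: ler_sum => e _; case: (hw e) => _ _; rewrite lerBlDr.
rewrite big_split /= lerD //.
  rewrite (le_trans (norm_le _ Dw)) // ler_piMr //.
  by apply: bigmax_le => // e _; case: (hw e).
rewrite sumr_const -[X in X <= _]mulr_natl mulrCA ler_piMr ?(ltW d0) // ler_pdivrMr // mul1r ler_nat.
exact: leqnSn.
Qed.
End SignDecomposition.

(** * Spaces of continuous functions *)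

Section CKSpace.
Variables (R : realType) (K : topologicalType).
Local Notation C := R[i].
Implicit Types g h : K -> C.

Lemma continuous_sumr (I : Type) (r : seq I) (F : I -> K -> R) :
  (forall i, continuous (F i)) -> continuous (fun y => \sum_(i <- r) F i y).
Proof.
move=> cF; elim: r => [|i r IH] y.
  by under eq_fun do rewrite big_nil; exact: cvg_cst.
under eq_fun do rewrite big_cons.
by apply: cvgD; [exact: cF|exact: IH].
Qed.

Lemma is_CK_lin (x : C) g h : is_CK g -> is_CK h -> is_CK (fun y => x * g y + h y).
Proof.
case: x => a b [cg1 cg2] [ch1 ch2]; split.
  have -> : (fun y => complex.Re (Complex a b * g y + h y)) =
    (fun y => a * complex.Re (g y) - b * complex.Im (g y) + complex.Re (h y)).
    by apply/funext => y; case: (g y) (h y) => [? ?] [].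
  move=> y; apply: cvgD; last exact: ch1.
  by apply: cvgB; apply: cvgM; [exact: cvg_cst|exact: cg1|exact: cvg_cst|exact: cg2].
have -> : (fun y => complex.Im (Complex a b * g y + h y)) =
    (fun y => a * complex.Im (g y) + b * complex.Re (g y) + complex.Im (h y)).
  by apply/funext => y; case: (g y) (h y) => [? ?] [].
move=> y; apply: cvgD; last exact: ch2.
by apply: cvgD; apply: cvgM; [exact: cvg_cst|exact: cg2|exact: cvg_cst|exact: cg1].
Qed.

Lemma is_CK0 : is_CK (fun _ : K => 0 : C).
Proof. by split => y; exact: cvg_cst. Qed.

Lemma is_CK_sum (I : Type) (r : seq I) (x : I -> C) (g : I -> K -> C) :
  (forall i, is_CK (g i)) -> is_CK (fun y => \sum_(i <- r) x i * g i y).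
Proof.
move=> cg; elim: r => [|i r IH].
  by under eq_fun do rewrite big_nil; exact: is_CK0.
by under eq_fun do rewrite big_cons; exact: is_CK_lin.
Qed.

Lemma is_CK_real (h : K -> R) : continuous h -> is_CK (fun y => (h y)%:C%C).
Proof. by move=> ch; split => //= y; exact: cvg_cst. Qed.

(* The partition is built from the distance that the functions [g] induce on [K]. *)
Lemma partition_of_unity (A : finType) (g : A -> K -> C) (d : R) :
  compact [set: K] -> (forall a, is_CK (g a)) -> 0 < d ->
  exists m, exists (x : 'I_m -> K) (h : 'I_m -> K -> R),
  [/\ forall k, continuous (h k), forall k y, 0 <= h k y, forall y, \sum_k h k y = 1 &
      forall a y, cabs (g a y - \sum_k g a (x k) * (h k y)%:C%C) <= d].
Proof.
move=> cK cg d0.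
pose dist z y := \sum_a (`|complex.Re (g a y) - complex.Re (g a z)| +
                       `|complex.Im (g a y) - complex.Im (g a z)|).
have cdist z : continuous (dist z).
  apply: continuous_sumr => a y; have [c1 c2] := cg a.
  by apply: cvgD; apply: cvg_norm; apply: cvgB; [exact: c1|exact: cvg_cst|exact: c2|exact: cvg_cst].
have dist_ge a z y : cabs (g a y - g a z) <= dist z y.
  rewrite (le_trans (cabs_le_ReIm _)) // /dist (bigD1 a) //= !raddfB /= lerDl.
  by rewrite sumr_ge0 // => b _; rewrite addr_ge0.
have distzz z : dist z z = 0 by rewrite /dist big1 // => a _; rewrite !subrr normr0 addr0.
have opU z : open [set y | dist z y < d].
  by apply: (@open_comp _ _ (dist z) [set r | r < d]) => [y _|]; [exact: cdist|exact: open_lt].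
have [s hs] : exists s : {fset K}, setT `<=` cover [set` s] (fun z => [set y | dist z y < d]).
  (* The cover formulation of compactness asks for a pointed type; an empty [K] is covered by the
     empty family. *)
  have [[y0 _]|noy] := pselect (exists y0 : K, True); last first.
    by exists fset0%fset => y _; case: noy; exists y.
  pose K' : ptopologicalType := HB.pack_for ptopologicalType K (isPointed.Build K y0).
  have : cover_compact [set: K'] by rewrite -compact_cover.
  move=> /(_ K' setT (fun z => [set y | dist z y < d])).
  case=> [z _|y _|s _ hs]; [exact: opU|by exists y => //=; rewrite distzz|by exists s].
pose m := size (enum_fset s); pose x (k : 'I_m) := tnth (in_tuple (enum_fset s)) k.
(* Tent functions on the balls of radius [d]. They are divided by their sum, which is positive
   because the balls cover [K]. *)
pose u (k : 'I_m) y := Num.max 0 (d - dist (x k) y).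
have u0 k y : 0 <= u k y by rewrite le_max lexx.
have cu k : continuous (u k).
  move=> y; apply: (@continuous_max _ _ (cst 0) (fun y => d - dist (x k) y)).
    exact: cvg_cst.
  by apply: cvgB; [exact: cvg_cst|exact: cdist].
have S0 y : 0 < \sum_k u k y.
  have [z /= zs dz] := hs y I.
  have zs' : (index z (enum_fset s) < m)%N by rewrite index_mem.
  rewrite (bigD1 (Ordinal zs')) //= ltr_pwDl ?sumr_ge0 // /u lt_max.
  by rewrite /x (tnth_nth z) /= nth_index // subr_gt0 dz orbT.
exists m, x, (fun k y => u k y / \sum_k u k y); split.
- move=> k y; apply: cvgM; first exact: cu.
  apply: cvgV; first by rewrite gt_eqF.
  exact: continuous_sumr.
- by move=> k y; rewrite divr_ge0 // ltW.
- by move=> y; rewrite -mulr_suml divff // gt_eqF.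
- move=> a y; set h := fun k => u k y / \sum_k u k y.
  have h0 k : 0 <= h k by rewrite divr_ge0 // ltW.
  have h1 : \sum_k h k = 1 by rewrite -mulr_suml divff // gt_eqF.
  have -> : g a y - \sum_k g a (x k) * (h k)%:C%C =
      \sum_k (g a y - g a (x k)) * (h k)%:C%C.
    under [RHS]eq_bigr do rewrite mulrBl.
    by rewrite sumrB -mulr_sumr -(raddf_sum (@real_complex R)) h1 mulr1.
  rewrite (le_trans (cabs_sum _ _ _)) // -[leRHS]mulr1 -h1 mulr_sumr ler_sum // => k _.
  rewrite cabsM cabs_real ger0_norm //.
  (* Only centres with $u_k(y) > 0$ contribute, and those lie within distance [d] of [y]. *)
  have [uk|uk] := ltP 0 (u k y); last first.
    by rewrite /h (_ : u k y = 0) ?mul0r ?mulr0 //; apply/eqP; rewrite eq_le uk u0.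
  rewrite ler_wpM2r // (le_trans (dist_ge _ _ _)) //.
  by move: uk; rewrite /u lt_max ltxx /= subr_gt0 => /ltW.
Qed.

Hypothesis cK : compact [set: K].

(** By a partition of unity with tolerance 1, [g] stays within 1 of convex combinations of finitely
    many of its values. *)
Lemma is_CK_bound g : is_CK g -> exists B, forall y, cabs (g y) <= B.
Proof.
move=> cg; have [m [x [h [_ h0 h1 hg]]]] :=
  @partition_of_unity unit (fun=> g) 1 cK (fun=> cg) ltr01.
exists (1 + \sum_k cabs (g (x k))) => y.
rewrite -(subrK (\sum_k g (x k) * (h k y)%:C%C) (g y)) (le_trans (cabsD _ _)) //.
rewrite lerD ?(hg tt) // (le_trans (cabs_sum _ _ _)) // ler_sum // => k _.
rewrite cabsM cabs_real ger0_norm // ler_piMr ?cabs_ge0 //.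
by rewrite -(h1 y) (bigD1 k) //= lerDl sumr_ge0.
Qed.

Lemma supn_ge g y : is_CK g -> cabs (g y) <= supn g.
Proof.
move=> /is_CK_bound[B hB].
exact: (@le_sup_cabs _ _ setT g B).
Qed.

Lemma supn_le g B : 0 <= B -> (forall y, cabs (g y) <= B) -> supn g <= B.
Proof. by move=> B0 hB; exact: (@sup_cabs_le _ _ setT g). Qed.
End CKSpace.

(** * The trace inequality *)

(** The signs of the real parts and those of the imaginary parts are both admissible choices of [e];
    each bounds one of the two sums in $\sum_k(|\Re z_k|+|\Im z_k|)$, whence the factor 2. *)
Lemma sum_cabs_le_signs (R : realType) m (z : 'I_m -> R[i]) (Q : R) :
  (forall e, cabs (\sum_k sgn R e k * z k) <= Q) -> \sum_k cabs (z k) <= 2 * Q.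
Proof.
move=> h; apply: le_trans (_ : \sum_k (`|complex.Re (z k)| + `|complex.Im (z k)|) <= _).
  by apply: ler_sum => k _; exact: cabs_le_ReIm.
rewrite big_split /= mulr_natl mulr2n.
have sgnE (e : {ffun 'I_m -> bool}) k : sgn R e k = ((-1) ^+ e k : R)%:C%C.
  by rewrite /sgn rmorphXn rmorphN1.
apply: lerD.
  pose e := [ffun k => complex.Re (z k) < 0].
  apply: le_trans (h e); apply: le_trans (Re_le_cabs _); apply: le_trans (ler_norm _).
  rewrite raddf_sum /= ler_sum // => k _; rewrite sgnE ffunE.
  have [|] := ltP (complex.Re (z k)) 0 => s; case: (z k) s => a b /= s.
    by rewrite expr1 ltr0_norm // mulN1r mul0r subr0.
  by rewrite expr0 ger0_norm // mul1r mul0r subr0.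
pose e := [ffun k => complex.Im (z k) < 0].
apply: le_trans (h e); apply: le_trans (Im_le_cabs _); apply: le_trans (ler_norm _).
rewrite raddf_sum /= ler_sum // => k _; rewrite sgnE ffunE.
have [|] := ltP (complex.Im (z k)) 0 => s; case: (z k) s => a b /= s.
  by rewrite expr1 ltr0_norm // mulN1r mul0r addr0.
by rewrite expr0 ger0_norm // mul1r mul0r addr0.
Qed.

Section Trace.
Variable R : realType.
Local Notation C := R[i].
Variables (n N l : nat) (T : 'I_l -> diffop R n N).
Local Notation nT := (normT T).
Variable K : topologicalType.
Hypothesis cK : compact [set: K].

(* [f |-> V f] is a Fourier multiplier of finite rank with trace [\sum_a v a]; the
   hypothesis bounds it from the Sobolev space [W^T_1] to [C^T]. *)
Lemma trace_bound :
  iso_compl_CK K (is_bidual T) (ddnorm T)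
      (fun x Psi1 Psi2 phi => x * Psi1 phi + Psi2 phi)
      (fun Psi1 Psi2 => forall phi, is_dual T phi -> Psi1 phi = Psi2 phi) ->
  exists2 M, 0 <= M & forall (A : finType) (xi : A -> 'I_n -> int) (v : A -> C) (B : R),
  0 <= B -> (forall a, is_dual T (hatc (xi a))) ->
  (forall f, is_trigpoly f -> exists D0, forall D, (D0 <= D)%N ->
    nT (fun t => \sum_a (v a * hatc (xi a) f) * mono (xi a) t) <=
      B * \sum_j gavg D (fun t => cabs (apply_op (T j) f t))) ->
  cabs (\sum_a v a) <= M * B.
Proof.
move=> [J [P [J_CK [J_lin [[MJ0 J_le0] [P_bi [P_lin [[MP0 P_le0] PJ]]]]]]]].
have [MJ MJ_ge0 J_le] : exists2 MJ, 0 <= MJ & forall v, is_bidual T v -> supn (J v) <= MJ * ddnorm T v.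
  exists `|MJ0| => // v bv; rewrite (le_trans (J_le0 _ bv)) // ler_wpM2r ?ler_norm //.
  exact: sup_cabs_ge0.
have [MP MP_ge0 P_le] : exists2 MP, 0 <= MP & forall g, is_CK g -> ddnorm T (P g) <= MP * supn g.
  exists `|MP0| => // g cg; rewrite (le_trans (P_le0 _ cg)) // ler_wpM2r ?ler_norm //.
  exact: (@sup_cabs_ge0 _ _ setT).
(* [MJ] and [MP] bound the embedding and the projection, 2 comes from the passage to signed sums,
   and [l] from the sum over the operators. *)
exists (MP * (MJ * (2 * l%:R))); first by rewrite !mulr_ge0.
move=> A xi v B B0 hdual hV.
have P_app g phi : is_CK g -> is_dual T phi -> cabs (P g phi) <= MP * supn g * dnorm T phi.
  move=> cg dphi; rewrite (le_trans (ddnorm_ge (P_bi _ cg) dphi)) //.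
  by rewrite ler_wpM2r ?dnormT_ge0 ?P_le.
have P0 phi : is_dual T phi -> P (fun=> 0) phi = 0.
  move=> dphi; have := P_lin (-1) _ _ (@is_CK0 R K) (@is_CK0 R K) _ dphi.
  by rewrite !(mulN1r, addNr).
have P_sum (I : Type) (r : seq I) (c : I -> C) (h : I -> K -> C) phi :
    (forall i, is_CK (h i)) -> is_dual T phi ->
    P (fun y => \sum_(i <- r) c i * h i y) phi = \sum_(i <- r) c i * P (h i) phi.
  move=> ch dphi; elim: r => [|i r IH].
    by under eq_fun do rewrite big_nil; rewrite P0 // big_nil.
  under eq_fun do rewrite big_cons.
  by rewrite P_lin ?big_cons ?IH //; exact: is_CK_sum.
pose iota f := fun phi : tfun R n -> C => phi f.
have bi_iota a : is_bidual T (iota (mono (xi a))) by exact/is_bidual_eval/trigpoly_mono.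
pose g a := J (iota (mono (xi a))).
have cg a : is_CK (g a) by exact: J_CK.
have J0 : J (fun=> 0) = fun=> 0.
  have := J_lin (-1) _ _ (@is_bidual0 _ _ _ _ T) (@is_bidual0 _ _ _ _ T).
  rewrite !(mulN1r, addNr) => ->; apply/funext => y.
  by rewrite mulN1r addNr.
have J_sum (c : A -> C) : J (fun phi => \sum_a c a * phi (mono (xi a))) =
    fun y => \sum_a c a * g a y.
  elim: (index_enum A) => [|a r IH].
    by under eq_fun do rewrite big_nil; rewrite J0; apply/funext => y; rewrite big_nil.
  under eq_fun do rewrite big_cons.
  rewrite (J_lin _ (iota (mono (xi a)))) //; last first.
    exact: (@is_bidual_sum _ _ _ _ T _ r c (fun a => iota (mono (xi a)))).
  by rewrite IH; apply/funext => y; rewrite big_cons.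
pose W := \sum_a cabs (v a) * dnorm T (hatc (xi a)).
have W0 : 0 <= W by rewrite sumr_ge0 // => a _; rewrite mulr_ge0 ?cabs_ge0 ?dnormT_ge0.
apply/ler_addgt0Pr => eps eps0.
(* With this tolerance the error of the partition of unity changes the trace by at most [eps]; the
   summand 1 keeps the denominator positive. *)
pose d := eps / (MP * W + 1).
have MW : 0 < MP * W + 1 by rewrite ltr_wpDl ?mulr_ge0.
have d0 : 0 < d by rewrite divr_gt0.
have dW : MP * d * W <= eps.
  rewrite mulrAC mulrC /d mulrAC ler_pdivrMr // ler_wpM2l ?(ltW eps0) //.
  by rewrite lerDl.
have [m [x [h [ch h0 h1 hg]]]] := partition_of_unity cK cg d0.
pose hC k y := (h k y)%:C%C.
have chC k : is_CK (hC k) by exact: is_CK_real.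
(* This is the value at [x k] of [J] applied to the image of [f] under the multiplier. *)
pose omega k f := \sum_a (v a * g a (x k)) * hatc (xi a) f.
have omega_dual k : is_dual T (omega k) by exact: is_dual_sum.
have omega_le1 k f : is_trigpoly f ->
    cabs (omega k f) <= MJ * nT (fun t => \sum_a (v a * hatc (xi a) f) * mono (xi a) t).
  move=> tf; pose c a := v a * hatc (xi a) f.
  have -> : omega k f = J (fun phi => \sum_a c a * phi (mono (xi a))) (x k).
    by rewrite J_sum; apply: eq_bigr => a _; rewrite mulrAC.
  have bi : is_bidual T (fun phi => \sum_a c a * phi (mono (xi a))).
    exact: (@is_bidual_sum _ _ _ _ T _ _ c (fun a => iota (mono (xi a)))).
  rewrite (le_trans (supn_ge cK (x k) (J_CK _ bi))) // (le_trans (J_le _ bi)) //.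
  rewrite ler_wpM2l // ddnorm_le ?normT_ge0 // => phi dphi.
  rewrite -(dual_sum _ _ dphi); last by move=> a; exact: trigpoly_mono.
  rewrite mulrC dnorm_ge //; apply: trigpoly_sum => a; exact: trigpoly_mono.
pose B' := MJ * (2 * l%:R) * B.
have B'0 : 0 <= B' by rewrite !mulr_ge0.
have omega_le (f : 'I_m -> tfun R n) : (forall k, is_trigpoly (f k)) ->
    cabs (\sum_k omega k (f k)) <=
    B' * \big[Num.max/0]_(e : {ffun 'I_m -> bool}) nT (fun t => \sum_k sgn R e k * f k t).
  move=> tf; set Q := (X in _ <= B' * X).
  have /choice[D0 hD0] := fun k => hV (f k) (tf k).
  (* One nonempty grid fine enough for all [f k], so that the averages can be added and estimated
     pointwise. *)
  pose D := (\max_k D0 k).+1.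
  apply: le_trans (cabs_sum _ _ _) _.
  apply: (@le_trans _ _ (\sum_k MJ * (B * \sum_j gavg D (fun t => cabs (apply_op (T j) (f k) t))))).
    apply: ler_sum => k _; rewrite (le_trans (omega_le1 k _ (tf k))) // ler_wpM2l //.
    by apply: hD0; rewrite leqW // leq_bigmax.
  rewrite -mulr_sumr -mulr_sumr exchange_big /= /B' -!mulrA ler_wpM2l //.
  rewrite [leRHS](_ : _ = B * (l%:R * (2 * Q))); last by ring.
  rewrite ler_wpM2l // mulr_natl -[l in _ *+ l]card_ord -sumr_const ler_sum // => j _.
  rewrite -gavg_rsum -[leRHS](@gavg_cst _ n D) // gavg_le // => t.
  apply: sum_cabs_le_signs => e.
  have -> : \sum_k sgn R e k * apply_op (T j) (f k) t =
     apply_op (T j) (fun t => \sum_k sgn R e k * f k t) t by rewrite apply_op_sum.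
  rewrite (le_trans (normT_ge T j t _)) //; first exact: trigpoly_sum.
  exact: (le_bigmax _ (fun e => nT (fun t => \sum_k sgn R e k * f k t))).
have [theta [theta_dual omegaE theta_le]] := sign_decomposition B'0 omega_dual omega_le.
(* Exchanging the sums over [k] and [e] pairs [theta e] with $P(\sum_k\pm h_k)$. As the $h_k$ are
   nonnegative with sum 1, every signed sum has sup norm at most 1. *)
have main : cabs (\sum_k P (hC k) (omega k)) <= MP * B'.
  have -> : \sum_k P (hC k) (omega k) =
      \sum_e P (fun y => \sum_k sgn R e k * hC k y) (theta e).
    under [RHS]eq_bigr => e _ do rewrite P_sum //.
    rewrite exchange_big /=; apply: eq_bigr => k _.
    rewrite -(bidual_sum _ _ (P_bi _ (chC k))) //.
    apply: (bidual_ext (P_bi _ (chC k))) => //; first exact: is_dual_sum.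
    by move=> f tf; exact: omegaE.
  rewrite (le_trans (cabs_sum _ _ _)) // (le_trans _ (ler_wpM2l MP_ge0 theta_le)) //.
  rewrite mulr_sumr ler_sum // => e _.
  rewrite (le_trans (P_app _ _ (is_CK_sum _ _ chC) (theta_dual e))) //.
  rewrite ler_wpM2r ?dnormT_ge0 // ler_piMr //; apply: supn_le => // y.
  rewrite (le_trans (cabs_sum _ _ _)) // -(h1 y) ler_sum // => k _.
  by rewrite cabsM cabs_sgn mul1r cabs_real ger0_norm.
pose rest a y := g a y - \sum_k g a (x k) * hC k y.
have crest a : is_CK (rest a).
  have := is_CK_lin (-1) (is_CK_sum (index_enum 'I_m) (fun k => g a (x k)) chC) (cg a).
  by congr is_CK; apply/funext => y; rewrite mulN1r addrC.
(* Since [P] inverts [J], [P (g a)] at the coefficient functional of [xi a] is the coefficient 1 of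
   the monomial itself; the partition of unity then splits [g a]. *)
have PgE a : 1 = \sum_k g a (x k) * P (hC k) (hatc (xi a)) + P (rest a) (hatc (xi a)).
  rewrite -P_sum // -[X in X + _]mul1r -P_lin //; last exact: is_CK_sum.
  have -> : (fun y => 1 * (\sum_k g a (x k) * hC k y) + rest a y) = g a.
    by apply/funext => y; rewrite mul1r addrC /rest subrK.
  by rewrite PJ // /iota hatc_mono.
have -> : \sum_a v a = \sum_k P (hC k) (omega k) + \sum_a v a * P (rest a) (hatc (xi a)).
  under eq_bigr => a _ do rewrite -[v a]mulr1 {1}(PgE a) mulrDr mulr_sumr.
  rewrite big_split /= exchange_big /=; congr (_ + _); apply: eq_bigr => k _.
  rewrite (bidual_sum _ _ (P_bi _ (chC k))) //.
  by apply: eq_bigr => a _; rewrite mulrA.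
rewrite (le_trans (cabsD _ _)) // lerD //; first by rewrite (le_trans main) // /B' !mulrA.
apply: le_trans dW; rewrite (le_trans (cabs_sum _ _ _)) // /W mulr_sumr ler_sum // => a _.
rewrite cabsM mulrCA ler_wpM2l ?cabs_ge0 // (le_trans (P_app _ _ (crest a) (hdual a))) //.
rewrite ler_wpM2r ?dnormT_ge0 // ler_wpM2l //; apply: supn_le; first exact: ltW.
exact: hg.
Qed.
End Trace.

(** * Lacunary kernels *)

Lemma lacunary_sum_le (R : realType) (a t : nat -> R) :
  (forall k, 0 < a k) -> (forall k, 4 * a k <= a k.+1) ->
  (forall k, t k <= 2) -> (forall k, t k <= a k) -> (forall k, t k.+1 <= (a k)^-1) ->
  forall m, \sum_(k < m) t k <= 8.
Proof.
move=> a0 a4 t2 ta tV.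
(* Geometric sums on both sides of the index where [a] crosses 1: before it the last term dominates,
   after it the bound stays below 8 with room $4/a_m$ for the remaining tail. *)
have step m : (a m <= 1 -> \sum_(k < m.+1) t k <= 2 * a m) /\
    (1 < a m -> \sum_(k < m.+1) t k <= 8 - 4 * (a m)^-1).
  elim: m => [|m [IH1 IH2]].
    rewrite big_ord_recr big_ord0 /= add0r; split => h.
      by have := ta 0%N; have := a0 0%N; lra.
    have : (a 0%N)^-1 <= 1 by rewrite invf_le1 // ltW.
    by have := t2 0%N; lra.
  have hV : 4 * (a m.+1)^-1 <= (a m)^-1.
    rewrite -[leRHS]mul1r ler_pdivlMr // mulrAC ler_pdivrMr // mul1r; exact: a4.
  rewrite big_ord_recr /=; have [am|am] := leP (a m) 1.
    have := IH1 am; have := a0 m; have := a4 m; have := ta m.+1; have := t2 m.+1.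
    split => h; first lra.
    have : (a m.+1)^-1 <= 1 by rewrite invf_le1 // ltW.
    lra.
  have := IH2 am; have := a4 m; have := tV m.
  have : 0 < (a m)^-1 by rewrite invr_gt0.
  by split => h; lra.
case=> [|m]; first by rewrite big_ord0.
have [h1 h2] := step m; have [am|am] := leP (a m) 1.
  by have := h1 am; lra.
have : 0 < (a m)^-1 by rewrite invr_gt0.
by have := h2 am; lra.
Qed.

Section Kernel.
Variables (R : realType) (n : nat) (j0 : 'I_n).
Local Notation C := R[i].

Definition shf (xi : 'I_n -> int) (h : nat) : 'I_n -> int :=
  fun j => xi j + (if j == j0 then h%:Z else 0).

Lemma mono_shf xi h (t : 'I_n -> R) : mono (shf xi h) t = mono xi t * ee (t j0) ^+ h.
Proof.
rewrite /mono -eeMn -eeD; congr ee.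
transitivity (\sum_k ((xi k)%:~R * t k + (if k == j0 then h%:R * t k else 0))).
  apply: eq_bigr => k _; rewrite /shf intrD mulrDl; congr (_ + _).
  by case: ifP => _; rewrite ?mul0r // pmulrn.
by rewrite big_split -big_mkcond big_pred1_eq.
Qed.

(** With $w = e^{2\pi i t_{j_0}}$, block $k$ is a unimodular factor times
    $L_k^{-1}(1-w^{M_k})\sum_{h<L_k}w^h$. It is at most 2, at most $M_k|1-w|$ and, after summing the
    geometric series, at most $4/(L_k|1-w|)$. As $4M_k\le L_{k+1}$, the lacunary sum bound applies
    with $a_k=M_k|1-w|$. *)
Lemma kernel_bound (L M : nat -> nat) (xi : nat -> 'I_n -> int) :
  (forall k, 0 < L k <= M k)%N -> (forall k, 4 * M k <= L k.+1)%N ->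
  forall m (t : 'I_n -> R),
  cabs (\sum_(k < m) \sum_(h < L k) ((L k)%:R^-1 : C) *
    (mono (shf (xi k) h) t - mono (shf (xi k) (M k + h)) t)) <= 8.
Proof.
move=> LM LM4 m t; set w := ee (t j0).
have w1 i : cabs (w ^+ i) = 1 by rewrite cabsX cabs_ee expr1n.
pose F k := cabs ((L k)%:R^-1 * (1 - w ^+ M k) * \sum_(h < L k) w ^+ h).
have L0 k : (L k)%:R != 0 :> R by rewrite pnatr_eq0 -lt0n; case/andP: (LM k).
have M0 k : (0 < M k)%N by case/andP: (LM k) => /leq_trans; apply.
have LC k : cabs ((L k)%:R^-1 : C) = (L k)%:R^-1 by rewrite cabsV cabs_nat.
have w2 i : cabs (1 - w ^+ i) <= 2.
  by rewrite (le_trans (cabsD _ _)) // cabsN cabs1 w1.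
have geo i : cabs (\sum_(h < i) w ^+ h) <= i%:R.
  rewrite (le_trans (cabs_sum _ _ _)) //; under eq_bigr do rewrite w1.
  by rewrite sumr_const card_ord.
have Fle k : F k <= cabs (1 - w ^+ M k).
  rewrite /F !cabsM LC -mulrA mulrCA ler_piMr ?cabs_ge0 //.
  by rewrite ler_pdivrMl ?mulr1 ?geo // lt_def L0 ler0n.
have geoE i : cabs (1 - w ^+ i) = cabs (1 - w) * cabs (\sum_(h < i) w ^+ h).
  by rewrite cabsB subrX1 cabsM cabsB.
apply: (@le_trans _ _ (\sum_(k < m) F k)).
  rewrite (le_trans (cabs_sum _ _ _)) // ler_sum // => k _.
  rewrite (_ : \sum_(h < _) _ = mono (xi k) t *
      ((L k)%:R^-1 * (1 - w ^+ M k) * \sum_(h < L k) w ^+ h)).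
    by rewrite cabsM cabs_mono mul1r.
  rewrite !mulr_sumr; apply: eq_bigr => h _; rewrite !mono_shf -/w exprD; ring.
(* At $w=1$ every block vanishes; this case is separate because the lacunary bound requires
   $a_k>0$. *)
have [z0|z0] := eqVneq (cabs (1 - w)) 0.
  by rewrite big1 // => k _; apply/eqP; rewrite eq_le cabs_ge0 andbT (le_trans (Fle _)) // geoE z0 mul0r.
have zp : 0 < cabs (1 - w) by rewrite lt_def z0 cabs_ge0.
apply: (@lacunary_sum_le _ (fun k => (M k)%:R * cabs (1 - w)) F) => k.
- by rewrite mulr_gt0 // ltr0n.
- rewrite mulrA ler_wpM2r ?cabs_ge0 // -natrM ler_nat.
  by apply: leq_trans (LM4 k) _; case/andP: (LM k.+1).
- exact: le_trans (Fle _) (w2 _).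
- by rewrite (le_trans (Fle _)) // geoE mulrC ler_wpM2r ?cabs_ge0.
- have Lp : 0 < (L k.+1)%:R :> R by rewrite lt_def L0 ler0n.
  have Mp : 0 < (M k)%:R :> R by rewrite ltr0n.
  rewrite -[leRHS]mul1r ler_pdivlMr ?mulr_gt0 //.
  have : 4 * (M k)%:R <= (L k.+1)%:R :> R by rewrite -natrM ler_nat.
  rewrite /F !cabsM LC => h.
  have h3 : cabs (\sum_(h < L k.+1) w ^+ h) * cabs (1 - w) <= 2 by rewrite mulrC -geoE.
  have h4 : cabs (1 - w ^+ M k.+1) * (cabs (\sum_(h < L k.+1) w ^+ h) * cabs (1 - w)) <= 2 * 2.
    by rewrite ler_pM ?mulr_ge0 ?cabs_ge0.
  rewrite [leLHS](_ : _ = (L k.+1)%:R^-1 * ((M k)%:R * (cabs (1 - w ^+ M k.+1) *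
    (cabs (\sum_(h < L k.+1) w ^+ h) * cabs (1 - w))))); last by ring.
  rewrite ler_pdivrMl // mulr1 (le_trans (ler_wpM2l (ltW Mp) h4)) //; lra.
Qed.
End Kernel.

(** * Points where the senior symbols are independent *)

Lemma digits_inj b n (a a' : nat -> nat) :
  (forall k, (k < n)%N -> a k < b /\ a' k < b)%N ->
  (\sum_(k < n) a k * b ^ k = \sum_(k < n) a' k * b ^ k)%N ->
  forall k, (k < n)%N -> a k = a' k.
Proof.
elim: n a a' => [|n IH] a a' hb e k //.
have [a0 a0'] := hb 0%N isT; have b0 : (0 < b)%N by exact: leq_ltn_trans a0.
have sE (c : nat -> nat) : (\sum_(k < n.+1) c k * b ^ k =
    (\sum_(k < n) c k.+1 * b ^ k) * b + c 0)%N.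
  rewrite big_ord_recl expn0 muln1 addnC; congr addn.
  by rewrite big_distrl; apply: eq_bigr => i _; rewrite /= expnSr mulnA.
move: e; rewrite !sE => e.
have e0 : a 0%N = a' 0%N by have := congr1 (modn^~ b) e; rewrite /= !modnMDl !modn_small.
move: e; rewrite e0 => /addIn/eqP; rewrite eqn_pmul2r // => /eqP e.
case: k => [//|k] kn.
by apply: (IH (fun k => a k.+1) (fun k => a' k.+1)) => // i ni; exact: hb.
Qed.

Section Select.
Variables (R : realType) (n N : nat).
Local Notation C := R[i].
Implicit Types (c : diffop R n N) (p q : 'I_n -> R).

Lemma poly_real_eq0 (P : {poly C}) : (forall s : R, P.[s%:C%C] = 0) -> P = 0.
Proof.
move=> h; apply: (@roots_geq_poly_eq0 _ _ [seq (i%:R : R)%:C%C | i <- iota 0 (size P)]).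
- by apply/allP => _ /mapP[i _ ->]; rewrite /root h.
- rewrite map_inj_uniq ?iota_uniq // => i j /complexI/eqP.
  by rewrite eqr_nat => /eqP.
- by rewrite size_map size_iota.
Qed.

(** On a line symbols become polynomials in one variable, so a product of them that vanishes along
    the line has a factor vanishing identically. *)
Lemma symb_line c p d : exists P : {poly C},
  forall s : R, symb c (fun k => p k + s * d k) = P.[s%:C%C].
Proof.
exists (\sum_alpha c alpha *: \prod_k ((ci (p k))%:P + ci (d k) *: 'X) ^+ mi alpha k) => s.
rewrite /symb horner_sum; apply: eq_bigr => alpha _; rewrite hornerZ; congr (_ * _).
rewrite /msym horner_prod; apply: eq_bigr => k _; rewrite horner_exp; congr (_ ^+ _).
by rewrite hornerD hornerZ hornerC hornerX /ci; simpc; congr Complex; ring.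
Qed.

(* Kronecker's substitution [x_k = s ^ (N ^ k)] separates the monomials. *)
Lemma symb_eq0 c : (forall x, symb c x = 0) -> forall alpha, c alpha = 0.
Proof.
move=> h alpha0; pose e (alpha : mindex n N) := (\sum_(k < n) alpha k * N ^ k)%N.
pose z (alpha : mindex n N) : C := \prod_(k < n) ci 1 ^+ alpha k.
have z0 alpha : z alpha != 0.
  apply/prodf_neq0 => k _; apply: expf_neq0; rewrite /ci eq_complex /= eqxx /=.
  by rewrite mulr1 mulf_neq0 ?pnatr_eq0 // gt_eqF ?pi_gt0.
have e_inj : injective e.
  move=> a a' ee; apply/ffunP => k; apply: val_inj.
  pose f (a : mindex n N) i : nat := oapp (fun k : 'I_n => a k : nat) 0%N (insub i).
  have fE b (i : 'I_n) : f b i = b i by rewrite /f valK.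
  rewrite /= -!fE; apply: (@digits_inj N n (f a) (f a')) => //.
    by move=> i ni; have := fE a (Ordinal ni); have := fE a' (Ordinal ni) => /= -> ->; rewrite !ltn_ord.
  by under eq_bigr do rewrite fE; under [RHS]eq_bigr do rewrite fE.
have : \sum_alpha (c alpha * z alpha) *: 'X^(e alpha) = 0 :> {poly C}.
  apply: poly_real_eq0 => s; rewrite horner_sum -[RHS](h (fun k => s ^+ (N ^ k))) /symb.
  apply: eq_bigr => alpha _; rewrite hornerZ hornerXn -mulrA; congr (_ * _).
  rewrite /z /e /msym -prodrXr /= -big_split /=; apply: eq_bigr => k _.
  rewrite -/(mi alpha k) [(_ * N ^ k)%N]mulnC exprM -exprMn; congr (_ ^+ _).
  by rewrite -rmorphXn /ci; apply/eqP; rewrite eq_complex /=; apply/andP; split; apply/eqP; ring.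
move=> /(congr1 (fun P : {poly C} => P`_(e alpha0))); rewrite coef0 coef_sum.
rewrite (bigD1 alpha0) //= coefZ coefXn eqxx mulr1 big1 ?addr0.
  by move/eqP; rewrite mulf_eq0 (negbTE (z0 _)) orbF => /eqP.
move=> alpha ne; rewrite coefZ coefXn (_ : (_ == _) = false) ?mulr0 //.
by apply/negbTE; apply: contra_neq ne => /e_inj.
Qed.

Variables c1 c2 : diffop R n N.
(** The determinant that vanishes exactly when the pairs of symbol values at [p] and [q] are
    linearly dependent. *)
Definition wedge p q := symb c1 p * symb c2 q - symb c2 p * symb c1 q.

(** Induction on the list of coordinates in which [p] and [q] may differ, through the point [mid]
    with coordinate [j] of [q] and the others of [p]. Dependence passes through [mid] if the symbols
    do not both vanish there; a polynomial argument removes this proviso. *)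
Lemma wedge_eq0 : (forall p j s, wedge p (upd p j s) = 0) -> forall p q, wedge p q = 0.
Proof.
move=> H.
suff claim (r : seq 'I_n) p q : (forall k, k \notin r -> p k = q k) -> wedge p q = 0.
  by move=> p q; apply: (claim (enum 'I_n)) => k; rewrite mem_enum.
elim: r p q => [|j r IH] p q.
  by move=> pq; rewrite (_ : q = p) /wedge; [ring|apply/funext => k; rewrite pq].
pose mid p q : 'I_n -> R := upd p j (q j).
have key p' q' i : (forall k, k \notin j :: r -> p' k = q' k) -> i \in [:: c1; c2] ->
    wedge p' q' * symb i (mid p' q') = 0.
  move=> pq; have h1 : wedge p' (mid p' q') = 0 by exact: H.
  have h2 : wedge (mid p' q') q' = 0.
    apply: IH => k kr; rewrite /mid /upd; case: eqP => [->//|/eqP kj].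
    by apply: pq; rewrite inE negb_or kj.
  rewrite !inE => /orP[]/eqP ->.
    transitivity (wedge (mid p' q') q' * symb c1 p' + wedge p' (mid p' q') * symb c1 q').
      by rewrite /wedge; ring.
    by rewrite h1 h2 !mul0r addr0.
  transitivity (wedge (mid p' q') q' * symb c2 p' + wedge p' (mid p' q') * symb c2 q').
    by rewrite /wedge; ring.
  by rewrite h1 h2 !mul0r addr0.
move=> pq; have [[i ic [p' hp']]|no] :=
  pselect (exists2 i, i \in [:: c1; c2] & exists p', symb i p' != 0); last first.
  have z i u : i \in [:: c1; c2] -> symb i u = 0.
    by move=> ic; apply/eqP; apply: contra_notT no => h; exists i => //; exists u.
  by rewrite /wedge !z ?inE ?eqxx ?orbT // mulr0 subrr.
(* Both points move along lines towards a common [p'] where a symbol is nonzero. They keep agreeing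
   off [j :: r], so [key] holds identically in the parameter. At parameter 1 the point [mid] is
   [p'], so [M] is nonzero and can be cancelled; parameter 0 gives the claim. *)
have [P1 hP1] := symb_line c1 p (fun k => p' k - p k).
have [P2 hP2] := symb_line c2 p (fun k => p' k - p k).
have [Q1 hQ1] := symb_line c1 q (fun k => p' k - q k).
have [Q2 hQ2] := symb_line c2 q (fun k => p' k - q k).
have [M hM] := symb_line i (mid p q) (fun k => p' k - mid p q k).
have : (P1 * Q2 - P2 * Q1) * M = 0.
  apply: poly_real_eq0 => s; rewrite hornerM hornerD hornerN !hornerM -hP1 -hP2 -hQ1 -hQ2 -hM.
  rewrite -[RHS](key (fun k => p k + s * (p' k - p k)) (fun k => q k + s * (p' k - q k)) i) //.
    rewrite /wedge; congr (_ * symb i _); apply/funext => k.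
    by rewrite /mid /upd; case: eqP => // ->.
  by move=> k /pq ->.
move/eqP; rewrite mulf_eq0 => /orP[/eqP PQ|/eqP M0]; last first.
  have := hM 1; rewrite M0 horner0 => h; move: hp'; rewrite -h => /eqP[]; congr symb.
  by apply/funext => k; ring.
have := congr1 (horner^~ 0%:C%C) PQ; rewrite horner0 hornerD hornerN !hornerM.
rewrite -hP1 -hP2 -hQ1 -hQ2 => <-; rewrite /wedge.
by congr (_ * _ - _ * _); congr symb; apply/funext => k; rewrite mul0r addr0.
Qed.

(** If all these determinants vanished, fixing [q0] where the symbol of [c1] is nonzero would give a
    linear relation between the two symbols, hence between the operators, as a symbol determines its
    coefficients. *)
Lemma exists_wedge_neq0 : lin_indep2 c1 c2 ->
  exists p j s, p j < s /\ wedge p (upd p j s) != 0.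
Proof.
move=> ind; have [p [j [s ne]]] : exists p j s, wedge p (upd p j s) != 0.
  apply: contrapT => no; have W := @wedge_eq0 _.
  have {}W p q : wedge p q = 0.
    apply: W => p' j s; apply/eqP; apply: contra_notT no => h; by exists p', j, s.
  have [q0 hq0] : exists q, symb c1 q != 0.
    apply: contrapT => no1; have z u : symb c1 u = 0.
      by apply/eqP; apply: contra_notT no1 => h; exists u.
    have [] := ind 1 0; last by move/eqP; rewrite oner_eq0.
    by move=> alpha; rewrite (symb_eq0 z) mulr0 mul0r addr0.
  have [] := ind (symb c2 q0) (- symb c1 q0); last first.
    by move=> _ /eqP; rewrite oppr_eq0 (negbTE hq0).
  apply: (@symb_eq0 (fun alpha => symb c2 q0 * c1 alpha + - symb c1 q0 * c2 alpha)) => x.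
  rewrite -[RHS](W x q0) /wedge {1}/symb.
  under eq_bigr do rewrite mulrDl -!mulrA.
  by rewrite big_split /= -!mulr_sumr -!/(symb _ _); ring.
have pp : upd p j (p j) = p by exact: upd_id.
(* By antisymmetry of [wedge] the two points may be swapped, which makes the changed coordinate
   increase. *)
have [ps|sp|e] := ltgtP (p j) s; first by exists p, j, s.
- exists (upd p j s), j, (p j); split; first by rewrite /upd eqxx.
  have -> : upd (upd p j s) j (p j) = p.
    by apply/funext => k; rewrite /upd; case: eqP => // ->.
  by rewrite (_ : wedge _ _ = - wedge p (upd p j s)) ?oppr_eq0 // /wedge; ring.
- by move: ne; rewrite -e pp /wedge mulrC subrr eqxx.
Qed.
End Select.

(** * Anisotropic dilations *)

Section Scaling.
Variables (R : realType) (n N : nat).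
Local Notation C := R[i].
Variable a : 'I_n -> R.
Hypothesis a_gt0 : forall k, 0 < a k.

(** Dilation by the factors $e^{m/a_k}$ multiplies the monomial of index $\alpha$ by
    $e^{m\sum_k\alpha_k/a_k}$. *)
Let rho k := expR (a k)^-1.

Lemma cvg_near_le0 (u : nat -> R) : u m @[m --> \oo] --> 0 ->
  forall eta, 0 < eta -> exists m0, forall m, (m0 <= m)%N -> `|u m| <= eta.
Proof.
move=> /cvgrPdist_le h eta eta0; have [m0 _ hm] := h _ eta0.
by exists m0 => m /hm /=; rewrite sub0r normrN.
Qed.

Lemma cvg_sumr (I : Type) (r : seq I) (F : I -> nat -> R) (l : I -> R) :
  (forall i, F i m @[m --> \oo] --> l i) ->
  \sum_(i <- r) F i m @[m --> \oo] --> \sum_(i <- r) l i.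
Proof.
move=> cF; elim: r => [|i r IH].
  by rewrite big_nil; under eq_fun do rewrite big_nil; exact: cvg_cst.
by rewrite big_cons; under eq_fun do rewrite big_cons; apply: cvgD.
Qed.

Lemma cvg_prodr (I : Type) (r : seq I) (F : I -> nat -> R) (l : I -> R) :
  (forall i, F i m @[m --> \oo] --> l i) ->
  \prod_(i <- r) F i m @[m --> \oo] --> \prod_(i <- r) l i.
Proof.
move=> cF; elim: r => [|i r IH].
  by rewrite big_nil; under eq_fun do rewrite big_nil; exact: cvg_cst.
by rewrite big_cons; under eq_fun do rewrite big_cons; apply: cvgM.
Qed.

Lemma cvg_powr (u : nat -> R) (l : R) d : u m @[m --> \oo] --> l ->
  u m ^+ d @[m --> \oo] --> l ^+ d.
Proof.
move=> cu; elim: d => [|d IH]; first by under eq_fun do rewrite expr0; exact: cvg_cst.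
by rewrite exprS; under eq_fun do rewrite exprS; apply: cvgM.
Qed.

Lemma cvg_expR_neg (d : R) : d < 0 -> expR d ^+ m @[m --> \oo] --> 0.
Proof. by move=> d0; apply: cvg_expr; rewrite gtr0_norm ?expR_gt0 // -expR0 ltr_expR. Qed.

Definition rmon (x : 'I_n -> R) (alpha : mindex n N) : R := \prod_(k < n) x k ^+ alpha k.

Lemma msymE x (alpha : mindex n N) : msym x (mi alpha) =
  (\prod_(k < n) ci 1 ^+ alpha k) * (rmon x alpha)%:C%C.
Proof.
rewrite /msym /rmon rmorph_prod /= -big_split /=; apply: eq_bigr => k _.
rewrite rmorphXn -exprMn; congr (_ ^+ _); apply/eqP; rewrite /ci eq_complex /=.
by apply/andP; split; apply/eqP; ring.
Qed.

Lemma prod_rho (alpha : mindex n N) : \prod_(k < n) rho k ^+ alpha k = expR (wdeg a alpha).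
Proof.
rewrite /wdeg (big_morph _ (@expRD R) (@expR0 R)); apply: eq_bigr => k _.
by rewrite /rho /mi -expRM_natl.
Qed.

(** After division by $e^m$, monomials of weighted degree below 1 decay and those of degree 1
    converge to their values at [x], since the error [B] is negligible against every factor
    $e^{m/a_k}$. *)
Lemma scaling_cvg (c : diffop R n N) x (zeta : nat -> 'I_n -> int) (B : R) :
  (forall alpha, c alpha != 0 -> wdeg a alpha <= 1) ->
  (forall m k, `|(zeta m k)%:~R - rho k ^+ m * x k| <= B) ->
  forall eta, 0 < eta -> exists m0, forall m, (m0 <= m)%N ->
  cabs (isymb c (zeta m) - (expR 1 ^+ m)%:C%C * symb (senior a c) x) <= eta * expR 1 ^+ m.
Proof.
move=> cdeg hz; pose y m k := (zeta m k)%:~R / rho k ^+ m.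
have rho0 k m : 0 < rho k ^+ m by rewrite exprn_gt0 // expR_gt0.
have cy k : y m k @[m --> \oo] --> x k.
  have cB : B * expR (- (a k)^-1) ^+ m @[m --> \oo] --> 0.
    rewrite -(mulr0 B); apply: cvgM; first exact: cvg_cst.
    by apply: cvg_expR_neg; rewrite oppr_lt0 invr_gt0.
  apply/cvgrPdist_le => e e0; have [m0 hm0] := cvg_near_le0 cB e0.
  exists m0 => // m /= /hm0 h; apply: le_trans h; apply: le_trans (ler_norm _).
  rewrite expRN exprVn -/(rho k) ler_pdivlMr ?rho0 // -(gtr0_norm (rho0 k m)) -normrM.
  by rewrite /y mulrBl divfK ?gt_eqF ?rho0 // distrC [x k * _]mulrC.
pose F (alpha : mindex n N) m := cabs (c alpha * \prod_(k < n) ci 1 ^+ alpha k) *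
  `|rmon (y m) alpha * expR (wdeg a alpha - 1) ^+ m -
    (if wdeg a alpha == 1 then 1 else 0) * rmon x alpha|.
have cF alpha : F alpha m @[m --> \oo] --> 0.
  have [c0|c0] := eqVneq (c alpha) 0.
    by rewrite /F; under eq_fun do rewrite c0 mul0r cabs0 mul0r; exact: cvg_cst.
  rewrite -[X in _ --> X](mulr0 (cabs (c alpha * \prod_(k < n) ci 1 ^+ alpha k))).
  apply: cvgM; first exact: cvg_cst.
  rewrite -[X in _ --> X](@normr0 _ R); apply: cvg_norm.
  have cr : rmon (y m) alpha @[m --> \oo] --> rmon x alpha.
    by apply: cvg_prodr => k; exact: cvg_powr.
  case: eqP => [->|/eqP ne].
    rewrite mul1r -[X in _ --> X](subrr (rmon x alpha)).
    apply: cvgB; last exact: cvg_cst.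
    by under eq_fun do rewrite subrr expR0 expr1n mulr1.
  under eq_fun do rewrite mul0r subr0.
  rewrite -(mulr0 (rmon x alpha)); apply: cvgM => //; apply: cvg_expR_neg.
  by rewrite subr_lt0 lt_neqAle ne cdeg.
move=> eta eta0; have [|m0 hm0] := @cvg_near_le0 (fun m => \sum_alpha F alpha m) _ _ eta0.
  have := @cvg_sumr _ (index_enum (mindex n N)) F (fun=> 0) cF.
  by rewrite [X in _ --> X]big1.
exists m0 => m /hm0 h.
have e0 : 0 < expR 1 ^+ m :> R by rewrite exprn_gt0 // expR_gt0.
apply: (@le_trans _ _ ((\sum_alpha F alpha m) * expR 1 ^+ m)); last first.
  by rewrite ler_wpM2r ?(ltW e0) // (le_trans (ler_norm _)).
rewrite /isymb /symb mulr_sumr -sumrB mulr_suml (le_trans (cabs_sum _ _ _)) //.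
apply: ler_sum => alpha _; rewrite !msymE /F.
set z := \prod_k ci 1 ^+ _.
have -> : rmon (fun k => (zeta m k)%:~R) alpha =
    rmon (y m) alpha * expR (wdeg a alpha - 1) ^+ m * expR 1 ^+ m.
  rewrite -mulrA -exprMn -expRD subrK -prod_rho /rmon -prodrXl -big_split /=.
  apply: eq_bigr => k _; rewrite exprAC -exprMn divfK // gt_eqF //.
set s := rmon (y m) alpha * _.
have -> : senior a c alpha = c alpha * (if wdeg a alpha == 1 then 1 else 0 : R)%:C%C.
  by rewrite /senior; case: ifP => _; rewrite ?mulr1 // mulr0.
set b := (if _ then _ else _).
rewrite (_ : _ - _ = c alpha * z * ((s - b * rmon x alpha) * expR 1 ^+ m)%:C%C); last first.
  by rewrite !rmorphM rmorphB !rmorphM /=; ring.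
by rewrite cabsM cabs_real normrM (gtr0_norm e0) mulrA.
Qed.

Variables (l : nat) (T : 'I_l -> diffop R n N).
Hypothesis T_deg : forall j alpha, T j alpha != 0 -> wdeg a alpha <= 1.
Variables (p : 'I_n -> R) (j0 : 'I_n) (s : R).
Hypothesis ps : p j0 < s.
Local Notation q := (upd p j0 s).
Local Notation tau j := (symb (senior a (T j))).

(** [xi] is the dilate of [p] rounded to integers and [M] the rounded dilate of the gap $s-p_{j_0}$,
    so a shift by [M] in direction [j0] leads to the dilate of [q] up to a bounded error. *)
Lemma exists_block (L Mmin : nat) (eta : R) : 0 < eta ->
  exists (xi : 'I_n -> int) (M : nat) (Lam : R), [/\ 0 < Lam, (Mmin <= M)%N &
  forall h j, (h < L)%N ->
    cabs (isymb (T j) (shf j0 xi h) - Lam%:C%C * tau j p) <= eta * Lam /\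
    cabs (isymb (T j) (shf j0 xi (M + h)) - Lam%:C%C * tau j q) <= eta * Lam].
Proof.
move=> eta0; pose xi m k := Num.floor (rho k ^+ m * p k).
pose M m := absz (Num.floor (rho j0 ^+ m * (s - p j0))).
have rho0 k m : 0 < rho k ^+ m by rewrite exprn_gt0 // expR_gt0.
have fl (x : R) : `|(Num.floor x)%:~R - x| <= 1.
  have /andP[h1 h2] := floor_itv x.
  by rewrite ler_distl; move: h1 h2; rewrite intrD => *; apply/andP; split; lra.
have ME m : ((M m)%:Z)%:~R = (Num.floor (rho j0 ^+ m * (s - p j0)))%:~R :> R.
  by rewrite /M gez0_abs // floor_ge0 mulr_ge0 ?(ltW (rho0 _ _)) // subr_ge0 ltW.
(* The bound $2+L$ covers at most two roundings and a shift [h < L], uniformly in [m]; thus [L] can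
   be fixed before the dilation. *)
have hz1 (h : 'I_L) m k : `|(shf j0 (xi m) h k)%:~R - rho k ^+ m * p k| <= 2 + L%:R.
  rewrite /shf intrD addrAC (le_trans (ler_normD _ _)) // lerD //.
    by rewrite (le_trans (fl _)) // ler1n.
  by case: ifP => _; rewrite ?normr0 // -pmulrn normr_nat ler_nat ltnW.
have hz2 (h : 'I_L) m k : `|(shf j0 (xi m) (M m + h) k)%:~R - rho k ^+ m * q k| <= 2 + L%:R.
  rewrite /shf /upd; case: eqP => [->|_]; last first.
    by rewrite addr0 (le_trans (fl _)) // ler_wpDr // ler1n.
  rewrite intrD PoszD intrD ME.
  rewrite (_ : _ - _ = ((xi m j0)%:~R - rho j0 ^+ m * p j0) +
     ((Num.floor (rho j0 ^+ m * (s - p j0)))%:~R - rho j0 ^+ m * (s - p j0)) + h%:R); last first.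
    by rewrite -pmulrn; ring.
  rewrite (le_trans (ler_normD _ _)) // lerD //; last by rewrite normr_nat ler_nat ltnW.
  by rewrite (le_trans (ler_normD _ _)) // (_ : 2 = 1 + 1) // lerD // fl.
have /choice[m1 hm1] : forall hj : 'I_L * 'I_l, exists m0, forall m, (m0 <= m)%N ->
    cabs (isymb (T hj.2) (shf j0 (xi m) hj.1) - (expR 1 ^+ m)%:C%C * tau hj.2 p) <= eta * expR 1 ^+ m.
  by move=> [h j]; exact: (@scaling_cvg (T j) p (fun m => shf j0 (xi m) h) _ (@T_deg j) (hz1 h) eta eta0).
have /choice[m2 hm2] : forall hj : 'I_L * 'I_l, exists m0, forall m, (m0 <= m)%N ->
    cabs (isymb (T hj.2) (shf j0 (xi m) (M m + hj.1)) - (expR 1 ^+ m)%:C%C * tau hj.2 q)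
    <= eta * expR 1 ^+ m.
  by move=> [h j]; exact: (@scaling_cvg (T j) q (fun m => shf j0 (xi m) (M m + h)) _ (@T_deg j) (hz2 h) eta eta0).
(* For large [m] the dilated gap reaches [Mmin + 1], which after rounding still leaves at least
   [Mmin]. *)
have [||m3 hm3] := @cvg_near_le0 (fun m => Mmin.+1%:R * expR (- (a j0)^-1) ^+ m) _ (s - p j0).
- rewrite -(mulr0 Mmin.+1%:R); apply: cvgM; first exact: cvg_cst.
  by apply: cvg_expR_neg; rewrite oppr_lt0 invr_gt0.
- by rewrite subr_gt0.
pose m := maxn m3 (maxn (\max_hj m1 hj) (\max_hj m2 hj)).
exists (xi m), (M m), (expR 1 ^+ m); split.
- by rewrite exprn_gt0 // expR_gt0.
- have := hm3 m (leq_maxl _ _); rewrite ger0_norm; last first.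
    by rewrite mulr_ge0 // exprn_ge0 // expR_ge0.
  rewrite expRN exprVn -/(rho j0) ler_pdivrMr ?rho0 // => h.
  rewrite -(ler_nat R) [leRHS]pmulrn ME.
  have := fl (rho j0 ^+ m * (s - p j0)); rewrite ler_distl => /andP[h1 _].
  by move: h; rewrite -natr1 mulrC => h; lra.
- move=> h j hL; split.
    apply: (hm1 (Ordinal hL, j)); rewrite leq_max; apply/orP; right.
    by rewrite leq_max leq_bigmax.
  apply: (hm2 (Ordinal hL, j)); rewrite leq_max; apply/orP; right.
  by rewrite leq_max leq_bigmax orbT.
Qed.
End Scaling.

(** * The multiplier *)

Section Multiplier.
Variables (R : realType) (n N l : nat) (T : 'I_l -> diffop R n N).
Local Notation C := R[i].
Variables j1 j2 : 'I_l.
Variables beta gamma : 'I_l -> C.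
Variables (A : finType) (xi xi' : A -> 'I_n -> int) (v e : A -> R).
Hypothesis v_ge0 : forall a, 0 <= v a.
Hypothesis e_ge0 : forall a, 0 <= e a.
Variable Kb Eb Bb : R.
Hypothesis kernel_le : forall t : 'I_n -> R,
  cabs (\sum_a (v a)%:C%C * (mono (xi a) t - mono (xi' a) t)) <= Kb.
Hypothesis e_le : \sum_a v a * e a <= Eb.
Local Notation S j := (isymb (T j)).
Hypothesis err_xi : forall a j,
  cabs (S j (xi a) - (beta j * S j2 (xi a) + gamma j * S j1 (xi a))) <=
  e a * (cabs (S j1 (xi a)) + cabs (S j2 (xi a))).
Hypothesis err_xi' : forall a j,
  cabs (beta j * S j2 (xi' a) + gamma j * S j1 (xi' a)) <=
  e a * (cabs (S j1 (xi' a)) + cabs (S j2 (xi' a))).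
Hypothesis coef_le : forall j, cabs (beta j) + cabs (gamma j) <= Bb.

Lemma hatc_unif (zeta : A -> 'I_n -> int) (f : tfun R n) : is_trigpoly f ->
  exists D0, forall D, (D0 <= D)%N -> forall a,
  gavg D (fun t => f t * mono (opp_freq (zeta a)) t) = hatc (zeta a) f.
Proof.
move=> tf; have /choice[D0 hD0] := fun a => hatcP (zeta a) tf.
exists (\max_a D0 a) => D hD a; apply: hD0; apply: leq_trans hD.
exact: leq_bigmax.
Qed.

(** At the frequencies [xi a] the operator $T_j$ is replaced by $\beta_jT_{j_2}+\gamma_jT_{j_1}$,
    and the same combination, small at [xi' a], is subtracted there. This leaves convolutions of
    $T_{j_2}f$ and $T_{j_1}f$ with the bounded kernel, plus errors controlled by [e]. *)
Lemma multiplier_bound f : is_trigpoly f -> exists D0, forall D, (D0 <= D)%N ->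
  normT T (fun t => \sum_a ((v a)%:C%C * hatc (xi a) f) * mono (xi a) t) <=
  (2 * (Bb * Kb + 2 * Eb)) * \sum_j gavg D (fun t => cabs (apply_op (T j) f t)).
Proof.
move=> tf.
have tT j : is_trigpoly (apply_op (T j) f) by exact: trigpoly_apply_op.
have [D1 h1] := hatc_unif xi (tT j1); have [D2 h2] := hatc_unif xi (tT j2).
have [D3 h3] := hatc_unif xi' (tT j1); have [D4 h4] := hatc_unif xi' (tT j2).
exists (maxn (maxn D1 D2) (maxn D3 D4)) => D.
rewrite !geq_max => /andP[/andP[DD1 DD2] /andP[DD3 DD4]].
have {}h1 := h1 _ DD1; have {}h2 := h2 _ DD2; have {}h3 := h3 _ DD3; have {}h4 := h4 _ DD4.
pose G j := gavg D (fun t => cabs (apply_op (T j) f t)).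
have G0 j : 0 <= G j.
  by rewrite /G /gavg mulr_ge0 ?invr_ge0 // sumr_ge0 // => *; exact: cabs_ge0.
have Kb0 : 0 <= Kb by exact: le_trans (cabs_ge0 _) (kernel_le (fun=> 0)).
have Eb0 : 0 <= Eb by apply: le_trans e_le; rewrite sumr_ge0 // => a _; rewrite mulr_ge0.
have Bb0 : 0 <= Bb by apply: le_trans (coef_le j1); rewrite addr_ge0 ?cabs_ge0.
have Gsum j : G j <= \sum_j G j by rewrite (bigD1 j) //= lerDl sumr_ge0.
have hle zeta j : gavg D (fun t => apply_op (T j) f t * mono (opp_freq zeta) t) =
    hatc zeta (apply_op (T j) f) -> cabs (S j zeta * hatc zeta f) <= G j.
  move=> h; rewrite -hatc_apply_op // -h (le_trans (cabs_gavg _ _)) // gavg_le // => t.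
  by rewrite cabsM cabs_mono mulr1.
have hle1 a := hle _ _ (h1 a); have hle2 a := hle _ _ (h2 a).
have hle3 a := hle _ _ (h3 a); have hle4 a := hle _ _ (h4 a).
apply: normT_le => [|j t].
  by apply: mulr_ge0; [apply: mulr_ge0 => //; rewrite addr_ge0 ?mulr_ge0|exact: sumr_ge0 (fun j _ => G0 j)].
rewrite apply_op_sum; last by move=> a; exact: trigpoly_mono.
pose Kj j := \sum_a (v a)%:C%C * (hatc (xi a) (apply_op (T j) f) * mono (xi a) t -
   hatc (xi' a) (apply_op (T j) f) * mono (xi' a) t).
pose err := \sum_a (v a)%:C%C *
   ((S j (xi a) - (beta j * S j2 (xi a) + gamma j * S j1 (xi a))) * hatc (xi a) f * mono (xi a) t +
   (beta j * S j2 (xi' a) + gamma j * S j1 (xi' a)) * hatc (xi' a) f * mono (xi' a) t).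
have -> : \sum_a (v a)%:C%C * hatc (xi a) f * apply_op (T j) (mono (xi a)) t =
    beta j * Kj j2 + gamma j * Kj j1 + err.
  rewrite /Kj /err !mulr_sumr -!big_split; apply: eq_bigr => a _ /=.
  by rewrite apply_op_mono !hatc_apply_op //; ring.
have Kj_le i : (forall a, gavg D (fun t => apply_op (T i) f t * mono (opp_freq (xi a)) t) =
      hatc (xi a) (apply_op (T i) f)) ->
    (forall a, gavg D (fun t => apply_op (T i) f t * mono (opp_freq (xi' a)) t) =
      hatc (xi' a) (apply_op (T i) f)) -> cabs (Kj i) <= Kb * G i.
  (* [Kj i] is the discrete convolution of $T_if$ with the kernel, so the sup bound [Kb] multiplies
     the averaged absolute value of $T_if$. *)
  move=> ha ha'; have -> : Kj i = gavg D (fun y => apply_op (T i) f y *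
      \sum_a (v a)%:C%C * (mono (xi a) (fun k => t k - y k) - mono (xi' a) (fun k => t k - y k))).
    transitivity (gavg D (fun y => \sum_a (v a)%:C%C * (mono (xi a) t *
       (apply_op (T i) f y * mono (opp_freq (xi a)) y) +
       (- mono (xi' a) t * (apply_op (T i) f y * mono (opp_freq (xi' a)) y) + 0)))).
      rewrite gavg_sum; apply: eq_bigr => a _; congr (_ * _).
      rewrite gavg_lin ha gavg_lin ha' /gavg [X in _ + (_ + X)]mulr_sumr big1 => [|? _]; last by rewrite mulr0.
      by rewrite addr0 mulNr; ring.
    congr gavg; apply/funext => y; rewrite mulr_sumr; apply: eq_bigr => a _.
    by rewrite !mono_sub addr0; ring.
  rewrite (le_trans (cabs_gavg _ _)) // /G -gavgZ gavg_le // => y.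
  by rewrite cabsM mulrC ler_wpM2r ?cabs_ge0.
have err_le : cabs err <= 2 * Eb * (G j1 + G j2).
  rewrite (le_trans (cabs_sum _ _ _)) //.
  apply: (@le_trans _ _ (\sum_a (v a * e a) * (2 * (G j1 + G j2)))); last first.
    rewrite -mulr_suml [2 * Eb]mulrC -mulrA ler_wpM2r //.
    by rewrite mulr_ge0 // addr_ge0.
  apply: ler_sum => a _; rewrite cabsM cabs_real ger0_norm // -[leRHS]mulrA ler_wpM2l //.
  rewrite (le_trans (cabsD _ _)) // mulr_natl mulrnAr mulr2n lerD //.
    rewrite !cabsM cabs_mono mulr1.
    rewrite (le_trans (ler_wpM2r (cabs_ge0 _) (err_xi a j))) //.
    by rewrite -mulrA ler_wpM2l // mulrDl -!cabsM lerD.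
  rewrite cabsM cabs_mono mulr1 cabsM.
  rewrite (le_trans (ler_wpM2r (cabs_ge0 _) (err_xi' a j))) //.
  by rewrite -mulrA ler_wpM2l // mulrDl -!cabsM lerD.
have hK1 := Kj_le _ h1 h3; have hK2 := Kj_le _ h2 h4.
have hG1 := Gsum j1; have hG2 := Gsum j2.
set Gs := \sum_j gavg D _; rewrite -/Gs in hG1 hG2.
have hb : cabs (beta j * Kj j2) + cabs (gamma j * Kj j1) <= Bb * (Kb * Gs).
  apply: (@le_trans _ _ ((cabs (beta j) + cabs (gamma j)) * (Kb * Gs))).
    rewrite mulrDl !cabsM lerD // ler_wpM2l ?cabs_ge0 //.
      by rewrite (le_trans hK2) // ler_wpM2l.
    by rewrite (le_trans hK1) // ler_wpM2l.
  by rewrite ler_wpM2r // mulr_ge0 // (le_trans (G0 j1)).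
rewrite (le_trans (cabsD _ _)) //.
have he : cabs err <= 2 * Eb * (2 * Gs).
  by rewrite (le_trans err_le) // ler_wpM2l ?mulr_ge0 // mulr_natl mulr2n lerD.
have hB0 : 0 <= Bb * (Kb * Gs) by rewrite !mulr_ge0 // (le_trans (G0 j1)).
rewrite [leRHS](_ : _ = 2 * (Bb * (Kb * Gs)) + 2 * Eb * (2 * Gs)); last by ring.
have := cabsD (beta j * Kj j2) (gamma j * Kj j1).
lra.
Qed.
End Multiplier.

(** * Lacunary blocks of frequencies and the contradiction for large trace *)

Lemma geometric_half_sum_le (R : realType) m : \sum_(k < m) (2^-1 : R) ^+ k <= 2.
Proof.
suff -> : \sum_(k < m) (2^-1 : R) ^+ k = 2 - 2 * 2^-1 ^+ m.
  by rewrite gerBl mulr_ge0 // exprn_ge0 // invr_ge0.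
elim: m => [|m IH]; first by rewrite big_ord0 expr0; ring.
by rewrite big_ord_recr /= IH exprS; field.
Qed.

Section Blocks.
Variables (R : realType) (n N l : nat) (T : 'I_l -> diffop R n N) (a : 'I_n -> R).
Local Notation C := R[i].
Hypothesis a_gt0 : forall k, 0 < a k.
Hypothesis T_deg : forall j alpha, T j alpha != 0 -> wdeg a alpha <= 1.
Variables (j1 j2 : 'I_l) (p : 'I_n -> R) (j0 : 'I_n) (s : R).
Hypothesis ps : p j0 < s.
Local Notation q := (upd p j0 s).
Local Notation tau j := (symb (senior a (T j))).
Local Notation W := (wedge (senior a (T j1)) (senior a (T j2)) p q).
Hypothesis W_neq0 : W != 0.
Local Notation S j := (isymb (T j)).

(* Cramer's rule for [beta tau_2 + gamma tau_1], prescribed to be [tau_j p] at [p] and 0 at [q]. *)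
Definition bcoef j : C := - (tau j p * tau j1 q) / W.
Definition gcoef j : C := tau j p * tau j2 q / W.
Definition bound_coef : R := \sum_j (cabs (bcoef j) + cabs (gcoef j)).

Lemma coef_p j : bcoef j * tau j2 p + gcoef j * tau j1 p = tau j p.
Proof.
rewrite /bcoef /gcoef [X in X + _]mulrAC [X in _ + X]mulrAC -mulrDl; apply: (mulIf W_neq0).
by rewrite divfK // /wedge; ring.
Qed.

Lemma coef_q j : bcoef j * tau j2 q + gcoef j * tau j1 q = 0.
Proof. by rewrite /bcoef /gcoef; ring. Qed.

Lemma coef_bound j : cabs (bcoef j) + cabs (gcoef j) <= bound_coef.
Proof. by rewrite /bound_coef (bigD1 j) //= lerDl sumr_ge0 // => i _; rewrite addr_ge0 ?cabs_ge0. Qed.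

(** The errors are relative to the symbols themselves and their bound halves with [k], so their
    weighted total stays bounded for any number of blocks. The first clause ensures that the
    coefficient functional at this frequency is bounded. *)
Definition good_shift k (xi : 'I_n -> int) M h : Prop :=
  [/\ 0 < cabs (S j1 (shf j0 xi h)) + cabs (S j2 (shf j0 xi h)),
    forall j, cabs (S j (shf j0 xi h) -
      (bcoef j * S j2 (shf j0 xi h) + gcoef j * S j1 (shf j0 xi h))) <=
      (1 + bound_coef) * 2^-1 ^+ k * (cabs (S j1 (shf j0 xi h)) + cabs (S j2 (shf j0 xi h))) &
    forall j, cabs (bcoef j * S j2 (shf j0 xi (M + h)) + gcoef j * S j1 (shf j0 xi (M + h))) <=
      (1 + bound_coef) * 2^-1 ^+ k *
        (cabs (S j1 (shf j0 xi (M + h))) + cabs (S j2 (shf j0 xi (M + h))))].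

(** The errors in [exists_block] are relative to the factor [Lam]. As [W] is nonzero, the senior
    symbols of [T j1] and [T j2] do not both vanish at [p], nor at [q]; so near the dilates the
    symbols are at least a constant times [Lam], and the errors become relative to them. *)
Lemma good_block k L : exists (xi : 'I_n -> int) (M : nat), (L <= M)%N /\
  forall h, (h < L)%N -> good_shift k xi M h.
Proof.
pose sp := cabs (tau j1 p) + cabs (tau j2 p); pose sq := cabs (tau j1 q) + cabs (tau j2 q).
have vec0 u : cabs (tau j1 u) + cabs (tau j2 u) = 0 -> tau j1 u = 0 /\ tau j2 u = 0.
  move=> h; have h1 := cabs_ge0 (tau j1 u); have h2 := cabs_ge0 (tau j2 u).
  by split; apply/eqP; rewrite -cabs_eq0; apply/eqP; lra.
have sp0 : 0 < sp.
  rewrite lt_def addr_ge0 ?cabs_ge0 // andbT; apply: contra_neqN W_neq0 => /eqP /vec0[e1 e2].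
  by rewrite /wedge e1 e2 !mul0r subrr.
have sq0 : 0 < sq.
  rewrite lt_def addr_ge0 ?cabs_ge0 // andbT; apply: contra_neqN W_neq0 => /eqP /vec0[e1 e2].
  by rewrite /wedge e1 e2 !mulr0 subrr.
pose sg := Num.min sp sq; have sg0 : 0 < sg by rewrite lt_min sp0 sq0.
(* Each of the two symbols loses at most [eta * Lam], so the factor 1/4 leaves [Lam * (sg / 2)] as a
   lower bound for the sum of their absolute values. *)
pose eta := sg / 4 * 2^-1 ^+ k.
have half0 : 0 < (2^-1 : R) ^+ k by rewrite exprn_gt0 // invr_gt0.
have half1 : (2^-1 : R) ^+ k <= 1 by rewrite exprn_ile1 // ?invr_ge0 // invf_le1 // ler1n.
have eta0 : 0 < eta by rewrite mulr_gt0 // divr_gt0.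
have eta_le : eta <= sg / 4 by rewrite ler_piMr // ltW // divr_gt0.
have [xi [M [Lam [Lam0 LM hblk]]]] := exists_block a_gt0 T_deg ps L L eta0.
exists xi, M; split => // h hL.
have low u z : sg <= cabs (tau j1 u) + cabs (tau j2 u) ->
    (forall j, cabs (S j z - Lam%:C%C * tau j u) <= eta * Lam) ->
    Lam * (sg / 2) <= cabs (S j1 z) + cabs (S j2 z).
  move=> hu hz.
  have lo j : Lam * cabs (tau j u) - eta * Lam <= cabs (S j z).
    have := cabsD (S j z) (Lam%:C%C * tau j u - S j z); rewrite addrC subrK.
    rewrite cabsM cabs_real gtr0_norm // cabsB => h1; have := hz j; lra.
  have := lo j1; have := lo j2; have : eta * Lam <= Lam * (sg / 4).
    by rewrite mulrC ler_wpM2l // ltW.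
  have := ler_wpM2l (ltW Lam0) hu; rewrite mulrDr; lra.
have Bc0 : 0 <= bound_coef by rewrite sumr_ge0 // => i _; rewrite addr_ge0 ?cabs_ge0.
have scale z x u : sg <= cabs (tau j1 u) + cabs (tau j2 u) ->
    (forall j, cabs (S j z - Lam%:C%C * tau j u) <= eta * Lam) ->
    x <= (1 + bound_coef) * (eta * Lam) ->
    x <= (1 + bound_coef) * 2^-1 ^+ k * (cabs (S j1 z) + cabs (S j2 z)).
  move=> hu hz hx; rewrite (le_trans hx) // -mulrA ler_wpM2l ?addr_ge0 //.
  have hl := low _ _ hu hz.
  rewrite (le_trans _ (ler_wpM2l (ltW half0) hl)) // /eta.
  rewrite [leLHS](_ : _ = 2^-1 ^+ k * (Lam * (sg / 4))); last by ring.
  have sg42 : sg / 4 <= sg / 2 by lra.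
  by apply: ler_wpM2l (ltW half0) _ _ _; exact: ler_wpM2l (ltW Lam0) _ _ sg42.
have hp j := (hblk h j hL).1; have hq j := (hblk h j hL).2.
have sgp : sg <= cabs (tau j1 p) + cabs (tau j2 p) by rewrite ge_min lexx.
have sgq : sg <= cabs (tau j1 q) + cabs (tau j2 q) by rewrite ge_min lexx orbT.
have comb z u j : (forall j, cabs (S j z - Lam%:C%C * tau j u) <= eta * Lam) ->
    cabs (bcoef j * (S j2 z - Lam%:C%C * tau j2 u) + gcoef j * (S j1 z - Lam%:C%C * tau j1 u))
    <= bound_coef * (eta * Lam).
  move=> hz; apply: le_trans (ler_wpM2r _ (coef_bound j)); last by rewrite mulr_ge0 ?ltW.
  rewrite (le_trans (cabsD _ _)) // (cabsM (bcoef j)) (cabsM (gcoef j)) mulrDl.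
  by apply: lerD; apply: ler_wpM2l; rewrite ?cabs_ge0.
split.
- by apply: lt_le_trans (low _ _ sgp hp); rewrite mulr_gt0 // divr_gt0.
- move=> j; apply: (scale _ _ _ sgp hp).
  set z := shf j0 xi h.
  have -> : S j z - (bcoef j * S j2 z + gcoef j * S j1 z) =
      (S j z - Lam%:C%C * tau j p) -
      (bcoef j * (S j2 z - Lam%:C%C * tau j2 p) + gcoef j * (S j1 z - Lam%:C%C * tau j1 p)).
    by rewrite -{1}(coef_p j); ring.
  apply: le_trans (cabsD _ _) _; rewrite cabsN mulrDl mul1r.
  by apply: lerD; [exact: hp|exact: comb hp].
- move=> j; apply: (scale _ _ _ sgq hq).
  set z := shf j0 xi (M + h).
  have -> : bcoef j * S j2 z + gcoef j * S j1 z =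
      bcoef j * (S j2 z - Lam%:C%C * tau j2 q) + gcoef j * (S j1 z - Lam%:C%C * tau j1 q).
    rewrite -[LHS]subr0 -[X in _ - X](mulr0 Lam%:C%C) -(coef_q j); ring.
  apply: le_trans (comb _ _ j hq) _; apply: ler_wpM2r; last by rewrite lerDr.
  by rewrite mulr_ge0 ?ltW.
Qed.

(** A multiplier with [m] blocks has trace [m], while its bound [B] does not depend on [m]; the
    trace inequality then fails for large [m]. *)
Lemma no_complement (K : topologicalType) : compact [set: K] ->
  ~ iso_compl_CK K (is_bidual T) (ddnorm T)
      (fun x Psi1 Psi2 phi => x * Psi1 phi + Psi2 phi)
      (fun Psi1 Psi2 => forall phi, is_dual T phi -> Psi1 phi = Psi2 phi).
Proof.
move=> cK /(trace_bound cK)[Mt Mt0 trace].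
have /choice[blk hblk] (kL : nat * nat) : exists x : ('I_n -> int) * nat,
    (kL.2 <= x.2)%N /\ forall h, (h < kL.2)%N -> good_shift kL.1 x.1 x.2 h.
  by have [xi [M H]] := good_block kL.1 kL.2; exists (xi, M).
(* The length of a block is four times the previous displacement, as the lacunarity in
   [kernel_bound] demands. The recursion is needed because the choice of [M k] depends on [L k]. *)
pose fix L k := if k is k'.+1 then (4 * (blk (k', L k')).2)%N else 1%N.
pose M k := (blk (k, L k)).2; pose xi k := (blk (k, L k)).1.
have LM k : (L k <= M k)%N by exact: (hblk (k, L k)).1.
have L0 k : (0 < L k)%N.
  by elim: k => //= k IH; rewrite muln_gt0 /=; exact: leq_trans IH (LM k).
have good k h : (h < L k)%N -> good_shift k (xi k) (M k) h by exact: (hblk (k, L k)).2.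
have Bc0 : 0 <= bound_coef by rewrite sumr_ge0 // => i _; rewrite addr_ge0 ?cabs_ge0.
pose E := 1 + bound_coef; have E0 : 0 <= E by rewrite addr_ge0.
(* Here 8 bounds the kernel and [E * 2] the geometric series of errors. *)
pose B := 2 * (bound_coef * 8 + 2 * (E * 2)).
have B0 : 0 <= B by rewrite !(mulr_ge0, addr_ge0).
have bnd m : m%:R <= Mt * B.
  (* One index per frequency: a block [k] with a shift below [L k]. The weight $1/L_k$ lets each
     block contribute 1 to the trace. *)
  pose A := {k : 'I_m & 'I_(L k)}.
  pose z (x : A) := shf j0 (xi (tag x)) (tagged x).
  pose z' (x : A) := shf j0 (xi (tag x)) (M (tag x) + tagged x).
  pose v (x : A) : R := (L (tag x))%:R^-1.
  pose e (x : A) : R := E * 2^-1 ^+ (tag x).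
  have sumA (V : zmodType) (F : forall k : 'I_m, 'I_(L k) -> V) :
      \sum_(x : A) F (tag x) (tagged x) = \sum_(k < m) \sum_(h < L k) F k h.
    by rewrite (sig_big_dep xpredT (fun _ => xpredT) F).
  have Ln0 k : (L k)%:R != 0 :> R by rewrite pnatr_eq0 -lt0n.
  have sumv (F : nat -> R) : \sum_(x : A) v x * F (tag x) = \sum_(k < m) F k.
    rewrite (sumA _ (fun k h => (L k)%:R^-1 * F k)); apply: eq_bigr => k _.
    by rewrite sumr_const card_ord -[LHS]mulr_natl mulrA divff // mul1r.
  have h := @trace A z (fun x => (v x)%:C%C) B B0.
  have := h _ _; rewrite (_ : \sum_x (v x)%:C%C = (m%:R)%:C%C); last first.
    rewrite -(raddf_sum (@real_complex R)) /=; congr (_%:C)%C.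
    under eq_bigr do rewrite -[v _]mulr1.
    by rewrite (sumv (fun=> 1)) sumr_const card_ord.
  rewrite cabs_real normr_nat; apply => [x|f tf].
    have [c0 _ _] := good _ _ (ltn_ord (tagged x)).
    have [c1|c1] := eqVneq (S j1 (z x)) 0; last exact: is_dual_hatc c1.
    apply: (@is_dual_hatc _ _ _ _ _ _ j2).
    by move: c0; rewrite -[shf _ _ _]/(z x) c1 cabs0 add0r cabs_gt0.
  have e0 x : 0 <= e x by rewrite mulr_ge0 // exprn_ge0 // invr_ge0.
  apply: (@multiplier_bound _ _ _ _ T j1 j2 bcoef gcoef A z z' v e) => //.
  - by move=> x; rewrite invr_ge0.
  - move=> t; rewrite (sumA _ (fun k h => (((L k)%:R^-1 : R)%:C)%C *
      (mono (shf j0 (xi k) h) t - mono (shf j0 (xi k) (M k + h)) t))).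
    have := @kernel_bound R n j0 L M xi _ _ m t.
    have LC k : ((L k)%:R^-1 : C) = (((L k)%:R^-1 : R)%:C)%C by rewrite fmorphV rmorph_nat.
    under eq_bigr => k _ do rewrite LC.
    by apply => // k; rewrite L0 LM.
  - rewrite (sumv (fun k => E * 2^-1 ^+ k)) -mulr_sumr ler_wpM2l //.
    exact: geometric_half_sum_le.
  - by move=> x j; have [_ h1 _] := good _ _ (ltn_ord (tagged x)); exact: h1.
  - by move=> x j; have [_ _ h1] := good _ _ (ltn_ord (tagged x)); exact: h1.
  - exact: coef_bound.
have := bnd (Num.truncn (Mt * B)).+1; apply/negP; rewrite -ltNge.
by rewrite truncnS_gt.
Qed.
End Blocks.

Theorem theorem1 (R : realType) (n N l : nat) (T : 'I_l -> diffop R n N)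
  (a : 'I_n -> R) :
  (0 < n)%N ->
  (forall k, 0 < a k) ->
  (forall j alpha, T j alpha != 0 -> wdeg a alpha <= 1) ->
  (exists j1 j2 : 'I_l,
      lin_indep2 (senior a (T j1)) (senior a (T j2))) ->
  forall K : topologicalType, hausdorff_space K -> compact [set: K] ->
  ~ iso_compl_CK K (is_bidual T) (ddnorm T)
      (fun x Psi1 Psi2 phi => x * Psi1 phi + Psi2 phi)
      (fun Psi1 Psi2 => forall phi, is_dual T phi -> Psi1 phi = Psi2 phi).
Proof.
move=> _ a0 Tdeg [j1 [j2 /exists_wedge_neq0[p [j0 [s [ps W0]]]]]] K _ cK.
exact: (no_complement a0 Tdeg ps W0 cK).
Qed.
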